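(* Let $A$ be a real isotropic $d\times d$ dilation matrix, let $\phi^m$ be the corresponding elliptic scaling function of order $m$, and let $\Delta^\sharp$ be the operator with symbol $$\widehat{\Delta^\sharp}(\xi):=\frac{P(\xi)}{M(\xi)}.$$ Then $$(\Delta^\sharp)^k\phi^m=\mathcal{G}^k\phi^{m-k},\qquad k<m,$$ where $\mathcal{G}$ is the finite-difference operator corresponding to the trigonometric polynomial $G$. The operator $\mathcal{G}$ is $\mathcal{G}:=-P(\mathcal{D}_1,\dots,\mathcal{D}_d)$, that is, $$\mathcal{G}f=-\sum_{i}q_{ii}\mathcal{D}_i^2f-2\sum_{i<j}q_{ij}\mathcal{D}_{ij}f .$$
   Context: A real isotropic dilation matrix is a $d\times d$ matrix $A$ with integer entries, all of whose eigenvalues are greater than $1$ in absolute value, which is diagonalizable over $\mathbb{C}$ and all of whose eigenvalues have equal absolute value. Put $q:=|\det A|$ and $A^{-T}:=(A^T)^{-1}$. One can factor $A^{-T}=q^{-1/d}Q^{-1}UQ$ with $U$ real orthogonal and $Q$ real symmetric positive definite; fix such a $Q$ and write $Q^2=(q_{ij})_{1\le i,j\le d}$. Define $$P(\xi):=\xi^TQ^2\xi=\sum_{i} q_{ii}\xi_i^2+2\sum_{i<j}q_{ij}\xi_i\xi_j,\qquad G(\xi):=4\sum_{i} q_{ii}\sin^2\frac{\xi_i}{2}+2\sum_{i<j}q_{ij}\sin\xi_i\sin\xi_j .$$ Let $S(A^T):=\{s\in[0,1)^d: A^Ts\in\mathbb{Z}^d\}$ (this set has $q$ elements and contains $0$),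 and define the mask $$m_0(\xi):=\prod_{s\in S(A^T)\setminus\{0\}}\frac{G(\xi+2\pi s)}{G(2\pi s)}.$$ Define $$\mu(\xi):=\frac{q^{2/d}\,m_0(A^{-T}\xi)\,G(A^{-T}\xi)}{G(\xi)},$$ where at the points of $2\pi\mathbb{Z}^d$ (zeros of $G$) the value is understood as the limit, and $M(\xi):=\prod_{j=0}^\infty\mu\bigl((A^{-T})^j\xi\bigr)$ (a positive continuous function). The elliptic scaling function $\phi$ is the tempered distribution with $\hat\phi(\xi)=\prod_{j=1}^\infty m_0((A^{-T})^j\xi)=\frac{G(\xi)}{P(\xi)}M(\xi)$ (with $G/P:=1$ at $\xi=0$); it is compactly supported. The elliptic scaling function of order $m$ is $\phi^1:=\phi$, $\phi^m:=\phi*\phi^{m-1}$, i.e. $\hat\phi^m(\xi)=(\hat\phi(\xi))^m$. The Fourier transform is $\hat f(\xi)=\int_{\mathbb{R}^d} f(x)e^{-i\xi\cdot x}\,dx$. The operator with symbol $\sigma$ acts by multiplication in the Fourier domain: $f\mapsto$ the distribution with Fourier transform $\sigma\hat f$. With $e_j$ the $j$th standard basis vector, $\mathcal{D}_j^2f:=f(\cdot-e_j)-2f+f(\cdot+e_j)$, and for $i\ne j$, $\mathcal{D}_i\mathcal{D}_j=\mathcal{D}_{ij}$ with $\mathcal{D}_{ij}f:=\frac14\bigl(f(\cdot-e_i-e_j)+f(\cdot+e_i+e_j)-f(\cdot-e_i+e_j)-f(\cdot+e_i-e_j)\bigr)$. The finite-difference operator corresponding to a trigonometric polynomial $T$ is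 the one acting as multiplication by $T(\xi)$ in the Fourier domain. Here $k,m$ are positive integers. *)

(* Defs.v *)
(* MathComp-Analysis; R : realType is arbitrary and the complex numbers are R[i]. *)
From HB Require Import structures.
From mathcomp Require Import all_boot all_order all_algebra.
From mathcomp Require Import all_classical all_reals all_analysis.
From mathcomp Require Import complex.
Set Implicit Arguments.
Unset Strict Implicit.
Unset Printing Implicit Defensive.
Import Order.TTheory GRing.Theory Num.Theory.
Import numFieldNormedType.Exports.
Local Open Scope classical_set_scope.
Local Open Scope ring_scope.

(** * Lebesgue measure on R^n *)

(** The library has no Lebesgue measure on R^n.  It is built on n-tuples, by
    recursion on n, as the image of the product measure on R * R^n under
    (x, t) |-> x :: t; [lebesgue_tuple_box] below checks its value on boxes. *)

Section lebesgue_cons.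
Context {R : realType} (n : nat).
Local Notation T := (n.-tuple (measurableTypeR R)).
Local Notation T' := (n.+1.-tuple (measurableTypeR R)).
Variable mu : {sigma_finite_measure set T -> \bar R}.

Definition tcons (p : measurableTypeR R * T) : T' := [tuple of p.1 :: p.2].

Lemma measurable_tcons : measurable_fun setT tcons.
Proof. exact: measurable_cons. Qed.

Lemma measurable_tcons_preimage (A : set T') :
  measurable A -> measurable (tcons @^-1` A).
Proof.
by move=> mA; rewrite -[X in measurable X]setTI; exact: measurable_tcons.
Qed.

Definition lebesgue_cons : set T' -> \bar R :=
  pushforward (lebesgue_measure \x mu)%E tcons.

Let lebesgue_cons0 : lebesgue_cons set0 = 0%E.
Proof. by rewrite /lebesgue_cons /pushforward preimage_set0 measure0. Qed.

Let lebesgue_cons_ge0 A : (0 <= lebesgue_cons A)%E.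
Proof. by rewrite /lebesgue_cons /pushforward; exact: measure_ge0. Qed.

Let lebesgue_cons_sigma_additive : semi_sigma_additive lebesgue_cons.
Proof.
move=> F mF tF mUF; rewrite /lebesgue_cons /pushforward preimage_bigcup.
apply: (@measure_semi_sigma_additive _ _ _ (lebesgue_measure \x mu)%E).
- by move=> k; exact: measurable_tcons_preimage.
- apply/trivIsetP => /= i j _ _ ij; rewrite -preimage_setI.
  by move/trivIsetP : tF => /(_ _ _ _ _ ij) ->//; rewrite preimage_set0.
- by rewrite -preimage_bigcup; exact: measurable_tcons_preimage.
Qed.

HB.instance Definition _ := isMeasure.Build _ _ _ lebesgue_cons
  lebesgue_cons0 lebesgue_cons_ge0 lebesgue_cons_sigma_additive.

Lemma lebesgue_cons_setX (A : set R) (B : set T) :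
  measurable (A : set (measurableTypeR R)) -> measurable B ->
  lebesgue_cons [set t | A (thead t) /\ B [tuple of behead t]] =
  (lebesgue_measure A * mu B)%E.
Proof.
move=> mA mB; rewrite -(product_measure1E lebesgue_measure mu mA mB).
rewrite /lebesgue_cons /pushforward; congr (_ _).
apply/seteqP; split => -[x t] /=; rewrite theadE.
- by case=> Ax Bt; split => //=; move: Bt; congr B; exact/val_inj.
- by case=> Ax Bt; split => //=; move: Bt; congr B; exact/val_inj.
Qed.

Lemma measurable_setX_tuple (A : set R) (B : set T) :
  measurable (A : set (measurableTypeR R)) -> measurable B ->
  measurable [set t : T' | A (thead t) /\ B [tuple of behead t]].
Proof.
move=> mA mB.
have -> : [set t : T' | A (thead t) /\ B [tuple of behead t]] =
    ((@tnth _ _ ^~ ord0) @^-1` A) `&` ((fun t : T' => [tuple of behead t]) @^-1` B).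
  by [].
apply: measurableI; rewrite -[X in measurable X]setTI.
- exact: measurable_tnth.
- exact: measurable_behead.
Qed.

Let lebesgue_cons_sigma_finite : sigma_finite setT lebesgue_cons.
Proof.
have /sigma_finiteP[F [TF ndF Foo]] := sigma_finiteT (@lebesgue_measure R).
have /sigma_finiteP[G [TG ndG Goo]] := sigma_finiteT mu.
exists (fun k => [set t : T' | F k (thead t) /\ G k [tuple of behead t]]).
  apply/esym; rewrite -subTset => t _.
  have [i _ Fi] : (\bigcup_k F k) (thead t) by rewrite -TF.
  have [j _ Gj] : (\bigcup_k G k) [tuple of behead t] by rewrite -TG.
  exists (maxn i j) => //; split.
  - by move: Fi; exact/subsetPset/ndF/leq_maxl.
  - by move: Gj; exact/subsetPset/ndG/leq_maxr.
move=> k; have [mF Fk] := Foo k; have [mG Gk] := Goo k; split.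
  exact: measurable_setX_tuple.
by rewrite lebesgue_cons_setX// lte_mul_pinfty// ge0_fin_numE.
Qed.

HB.instance Definition _ := Measure_isSigmaFinite.Build _ _ _ lebesgue_cons
  lebesgue_cons_sigma_finite.
End lebesgue_cons.

Fixpoint lebesgue_tuple (R : realType) (n : nat) :
    {sigma_finite_measure set (n.-tuple (measurableTypeR R)) -> \bar R} :=
  if n is m.+1 then lebesgue_cons (lebesgue_tuple R m)
  else \d_([tuple] : 0.-tuple (measurableTypeR R)).

Lemma lebesgue_tuple_box (R : realType) (n : nat) (A : 'I_n -> set R) :
  (forall i, measurable (A i : set (measurableTypeR R))) ->
  measurable [set t : n.-tuple (measurableTypeR R) | forall i, A i (tnth t i)] /\
  lebesgue_tuple R n [set t | forall i, A i (tnth t i)] =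
  (\big[*%E/1%E]_(i < n) lebesgue_measure (A i))%E.
Proof.
elim: n A => [|n IHn] A mA.
  have -> : [set t : 0.-tuple (measurableTypeR R) | forall i, A i (tnth t i)] = setT.
    by apply/seteqP; split => // t _ [].
  by split => //; rewrite big_ord0 /= diracT.
have -> : [set t : n.+1.-tuple (measurableTypeR R) | forall i, A i (tnth t i)] =
    [set t | A ord0 (thead t) /\
      [set t : n.-tuple (measurableTypeR R) | forall i, A (lift ord0 i) (tnth t i)]
      [tuple of behead t]].
  apply/seteqP; split => t /= At.
    split; first exact: At.
    by move=> i; have := At (lift ord0 i); rewrite [in X in X -> _](tuple_eta t) tnthS.
  move=> i; rewrite (tuple_eta t); case: (unliftP ord0 i) => [j ->|->].
  - by rewrite tnthS; exact: At.2.
  - by rewrite tnth0; exact: At.1.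
have [mB IHB] := IHn _ (fun i => mA (lift ord0 i)).
split; first exact: measurable_setX_tuple.
by rewrite big_ord_recl -IHB -lebesgue_cons_setX.
Qed.

(** * Schwartz functions and tempered distributions on R^d *)

Section distributions.
Context {R : realType} {d : nat}.
Local Notation V := 'cV[R]_d.
Local Notation C := R[i].
Implicit Types (f g h psi : V -> C) (l : seq 'I_d).

Definition Re_fun f : V -> R := fun x => complex.Re (f x).
Definition Im_fun f : V -> R := fun x => complex.Im (f x).
Definition cmod (z : C) : R := complex.Re `|z|.

Definition evec (j : 'I_d) : V := delta_mx j 0.

Fixpoint pderiv l (g : V -> R) : V -> R :=
  if l is i :: l' then fun x => 'D_(evec i) (pderiv l' g) x else g.

Definition cpderiv l f : V -> C :=
  fun x => Complex (pderiv l (Re_fun f) x) (pderiv l (Im_fun f) x).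

Definition smooth f := forall l (x : V),
  differentiable (pderiv l (Re_fun f)) x /\ differentiable (pderiv l (Im_fun f)) x.

Definition schwartz f := smooth f /\
  forall (N : nat) l, exists K : R, forall x : V,
    (1 + `|x|) ^+ N * cmod (cpderiv l f x) <= K.

(** Distributions are functionals on all functions; only their values on Schwartz
    functions are meaningful, and [dist_eq] is equality of distributions. *)
Definition dist := (V -> C) -> C.
Implicit Types u v w : dist.

Definition dist_eq u v := forall psi, schwartz psi -> u psi = v psi.

(** Linearity, and continuity for the Schwartz seminorms: |u psi| is at most a
    constant times max over |l| <= N of sup (1 + |x|)^N |D^l psi(x)|. *)
Definition tempered u :=
  (forall (a : C) f g, schwartz f -> schwartz g ->
     u (fun x => a * f x + g x) = a * u f + u g) /\
  exists (K : R) (N : nat), forall psi (B : R), schwartz psi ->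
    (forall l, (size l <= N)%N -> forall x : V,
       (1 + `|x|) ^+ N * cmod (cpderiv l psi x) <= B) ->
    cmod (u psi) <= K * B.

Definition col_of_tuple (t : d.-tuple (measurableTypeR R)) : V :=
  \col_i tnth t i.

Definition cintegral f : C :=
  Complex (\int[lebesgue_tuple R d]_t Re_fun f (col_of_tuple t))
          (\int[lebesgue_tuple R d]_t Im_fun f (col_of_tuple t)).

Definition dot (x y : V) : R := \sum_i x i 0 * y i 0.

Definition fourier f : V -> C := fun xi : V =>
  cintegral (fun x => f x * Complex (cos (dot xi x)) (- sin (dot xi x))).

Definition dist_fourier u : dist := fun psi => u (fourier psi).

(** Measurable functions of at most polynomial growth in the mean. *)
Definition tempered_fun h :=
  [/\ measurable_fun setT (Re_fun h \o col_of_tuple),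
      measurable_fun setT (Im_fun h \o col_of_tuple) &
      exists N : nat, (lebesgue_tuple R d).-integrable setT
        (fun t => (cmod (h (col_of_tuple t)) / (1 + `|col_of_tuple t|) ^+ N)%:E)].

Definition regular h : dist := fun psi => cintegral (fun x => h x * psi x).

(** [dist_prod sigma w w'] : w' is the product of the function sigma and the
    distribution w.  The product is defined when sigma is a multiplier of the
    Schwartz space and, for less regular sigma, when w and sigma w are functions. *)
Inductive dist_prod (sigma : V -> C) w w' : Prop :=
| dist_prod_multiplier :
    (forall psi, schwartz psi -> schwartz (fun x => sigma x * psi x)) ->
    dist_eq w' (fun psi => w (fun x => sigma x * psi x)) ->
    dist_prod sigma w w'
| dist_prod_regular h :
    tempered_fun h -> tempered_fun (fun x => sigma x * h x) ->
    dist_eq w (regular h) -> dist_eq w' (regular (fun x => sigma x * h x)) ->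
    dist_prod sigma w w'.

(** [symbol_op sigma u v] : the operator with symbol sigma maps u to v. *)
Definition symbol_op (sigma : V -> C) u v :=
  [/\ tempered u, tempered v & dist_prod sigma (dist_fourier u) (dist_fourier v)].

(** [op_iter T k u v] : T^k u = v, for an operator T given by its graph. *)
Fixpoint op_iter (T : dist -> dist -> Prop) (k : nat) u v : Prop :=
  if k is k'.+1 then exists2 w, T u w & op_iter T k' w v else dist_eq u v.

(** u (. - a) *)
Definition translate (a : V) u : dist := fun psi => u (fun x => psi (x + a)).

Definition D2 (j : 'I_d) u : dist := fun psi =>
  translate (evec j) u psi - 2 * u psi + translate (- evec j) u psi.

Definition D11 (i j : 'I_d) u : dist := fun psi =>
  4^-1 * (translate (evec i + evec j) u psi + translate (- evec i - evec j) u psi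
          - translate (evec i - evec j) u psi - translate (evec j - evec i) u psi).

End distributions.

(** * Elliptic scaling functions *)

Section elliptic.
Context {R : realType} {d : nat}.
Local Notation V := 'cV[R]_d.
Local Notation C := R[i].
Variables (A : 'M[int]_d) (Q : 'M[R]_d).

Definition isotropic_dilation :=
  let AC : 'M[C]_d := map_mx intr A in
  [/\ forall a, eigenvalue AC a -> 1 < `|a|,
      diagonalizable AC &
      forall a b, eigenvalue AC a -> eigenvalue AC b -> `|a| = `|b|].

Definition realA : 'M[R]_d := map_mx intr A.
Definition qdet : R := `|\det realA|.
Definition AmT : 'M[R]_d := invmx realA^T.

Definition elliptic_factor :=
  [/\ Q^T = Q,
      forall x : V, x != 0 -> 0 < (x^T *m Q *m x) 0 0 &
      exists2 U : 'M[R]_d, U^T *m U = 1%:M &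
        AmT = powR qdet (- d%:R^-1) *: (invmx Q *m U *m Q)].

Definition Q2 : 'M[R]_d := Q *m Q.

Definition formP (xi : V) : R := (xi^T *m Q2 *m xi) 0 0.

Definition trigG (xi : V) : R :=
  4 * (\sum_(i < d) Q2 i i * sin (xi i 0 / 2) ^+ 2)
  + 2 * (\sum_(i < d) \sum_(j < d | (i < j)%N) Q2 i j * (sin (xi i 0) * sin (xi j 0))).

Definition SAT : set V :=
  [set s : V | (forall i, 0 <= s i 0 < 1) /\ forall i, (realA^T *m s) i 0 \is a Num.int].

Definition m0 (xi : V) : R :=
  \big[*%R/1]_(s \in SAT `\ 0) (trigG (xi + (2 * pi) *: s) / trigG ((2 * pi) *: s)).

Definition mu_quot (xi : V) : R :=
  powR qdet (2 / d%:R) * m0 (AmT *m xi) * trigG (AmT *m xi) / trigG xi.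

(** The points of 2 pi Z^d, where trigG vanishes, get the limit of the quotient. *)
Definition mu (xi : V) : R :=
  if `[< forall i, xi i 0 / (2 * pi) \is a Num.int >]
  then lim (mu_quot x @[x --> xi^']) else mu_quot xi.

Definition prodM (xi : V) : R :=
  limn (fun n => \prod_(0 <= j < n) mu (iter j (mulmx AmT) xi)).

Definition phihat (xi : V) : R :=
  limn (fun n => \prod_(1 <= j < n.+1) m0 (iter j (mulmx AmT) xi)).

(** phi is the elliptic scaling function of order m: the convolution power is
    taken on the Fourier side. *)
Definition elliptic_scaling (m : nat) (phi : @dist R d) :=
  tempered phi /\
  dist_eq (dist_fourier phi) (regular (fun xi => real_complex R (phihat xi ^+ m))).

Definition Delta_symbol (xi : V) : C := real_complex R (formP xi / prodM xi).
Definition G_symbol (xi : V) : C := real_complex R (trigG xi).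

Definition calG (u : @dist R d) : @dist R d := fun psi =>
  - (\sum_(i < d) real_complex R (Q2 i i) * D2 i u psi)
  - 2 * (\sum_(i < d) \sum_(j < d | (i < j)%N) real_complex R (Q2 i j) * D11 i j u psi).

End elliptic.

(* Main.v *)
From HB Require Import structures.
Require Import Defs.
From mathcomp Require Import all_boot all_order all_algebra.
From mathcomp Require Import all_classical all_reals all_analysis.
From mathcomp Require Import complex.
From mathcomp Require Import ring lra zify measurable_realfun.
Set Implicit Arguments.
Unset Strict Implicit.
Unset Printing Implicit Defensive.
Import Order.TTheory GRing.Theory Num.Theory.
Import numFieldNormedType.Exports.
Local Open Scope classical_set_scope.
Local Open Scope ring_scope.

(** The second part of the theorem is the translation rule of the Fourier
    transform.  For a distribution [u], [translate a u] acts on the Fourier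
    transform of [psi] as [u] acts on the Fourier transform of
    [exp(- i a . x) psi], so a finite combination of translations has as symbol
    the same combination of characters ([has_symbol_translate],
    [has_symbol_lin]); for [calG Q] the characters add up to [trigG Q]
    ([has_symbol_calG]).  As [u] is linear on Schwartz functions only, this needs
    that the Fourier transform preserves the Schwartz space
    ([schwartz_fourier]).

    The first part is an identity of functions on the Fourier side,
    [P / M * (G ^ j * phihat ^ m) = G ^ (j + 1) * phihat ^ (m - 1)] for [m >= 2]
    ([Delta_symbol_phihat]), applied along the chain
    [phi m, G phi (m - 1), ..., G^k phi (m - k)]: the Fourier transforms of these
    distributions are the functions [G ^ j * phihat ^ (m - j)], which are
    measurable and of polynomial growth, so that the product with [P / M] is
    meaningful.

    The identity itself comes from [phihat = G / P * M].  Write [B] for the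
    inverse transpose of the dilation.  By the factorization of [B] through an
    orthogonal matrix, [P (B x) = rho ^ 2 * P x] with
    [rho = q ^ (- 1 / d) < 1] ([formP_AmT]); hence the iterates of [B] converge
    geometrically to 0 and the product of the [m0 (B ^ j x)] converges.  Away
    from the lattice [2 pi Z^d], which is the zero set of [G] because
    [G x = 4 (sum_i q_ii sin (x_i / 2) ^ 4 + P y)] with
    [y_i = sin (x_i / 2) cos (x_i / 2)] ([trigG_sos]), the product that defines
    [M] telescopes to [q ^ (2 n / d) * G (B ^ n x) / G x] times a partial product
    of [phihat], and [q ^ (2 n / d) * G (B ^ n x)] tends to [P x] since [G - P]
    vanishes to third order at 0 ([prodM_phihat]).  On the lattice, [G]
    vanishes, and so does [phihat] except at 0 ([phihat_lattice2pi]), where [P]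
    vanishes; both sides of the identity are then 0. *)

(** * Real trigonometry *)

Section real_trigonometry.
Context {R : realType}.

(** The order of the end points is left open, so that increments of either sign
    can be treated at once. *)
Lemma mean_value (f f' : R -> R) (a b : R) :
  (forall x : R, is_derive x (1 : R) f (f' x)) ->
  exists2 c, `|c - a| <= `|b - a| & f b - f a = f' c * (b - a).
Proof.
move=> df.
have cf u v : {within `[u, v], continuous f}.
  apply: derivable_within_continuous => x _; by have [] := df x.
have [ab|ba] := leP a b.
  have [c cab E] := MVT_segment ab (fun x _ => df x) (cf a b).
  exists c => //; move: cab; rewrite in_itv /= => /andP[ac cb].
  by rewrite !ger0_norm ?subr_ge0// lerB.
have [c cab E] := MVT_segment (ltW ba) (fun x _ => df x) (cf b a).
exists c; last by rewrite -opprB E -mulrN opprB.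
move: cab; rewrite in_itv /= => /andP[bc ca].
by rewrite !ler0_norm ?subr_le0 ?(ltW ba)// !opprB lerB.
Qed.

Lemma lipschitz_cos (a b : R) : `|cos b - cos a| <= `|b - a|.
Proof.
have [c _ ->] := mean_value a b (fun x => is_derive_cos x).
by rewrite normrM normrN ler_piMl// ler_norml sin_geN1 sin_le1.
Qed.

Lemma lipschitz_sin (a b : R) : `|sin b - sin a| <= `|b - a|.
Proof.
have [c _ ->] := mean_value a b (fun x => is_derive_sin x).
by rewrite normrM ler_piMl// ler_norml cos_geN1 cos_le1.
Qed.

(** The derivative of cosine is written as a shift of the phase by a quarter
    turn: sines and cosines then form a single family that is closed under
    differentiation. *)
Lemma taylor_cos (t s : R) : `|cos (t + s) - cos t - s * cos (t + pi / 2)| <= s ^+ 2.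
Proof.
have -> : cos (t + pi / 2) = - sin t.
  by rewrite cosD cos_pihalf sin_pihalf mulr0 mulr1 sub0r.
have [c] := mean_value t (t + s) (fun x => is_derive_cos x).
rewrite [t + s - t]addrC addKr => ct ->.
rewrite -real_normK ?num_real// expr2.
have -> : - sin c * s - s * - sin t = (sin t - sin c) * s by ring.
rewrite normrM ler_wpM2r//; apply: le_trans ct.
by rewrite (distrC c); exact: lipschitz_sin.
Qed.

(** The quadratic bound is cruder than the truth, but it suffices for a third
    order estimate of [trigG Q - formP Q]. *)
Lemma sin_approx (t : R) : `|sin t - t| <= t ^+ 2.
Proof.
have [c] := mean_value 0 t (fun x => is_derive_sin x).
rewrite sin0 !subr0 => ct ->.
have -> : cos c * t - t = (cos c - cos 0) * t by rewrite cos0; ring.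
rewrite normrM -real_normK ?num_real// expr2 ler_wpM2r//.
by apply: le_trans (lipschitz_cos _ _) _; rewrite subr0.
Qed.

Lemma sin_cos_int (n : int) : sin (n%:~R * pi) = 0 :> R /\ cos (n%:~R * pi) ^+ 2 = 1 :> R.
Proof.
have H (k : nat) : sin (k%:R * pi) = 0 :> R /\ cos (k%:R * pi) ^+ 2 = 1 :> R.
  elim: k => [|k [IHs IHc]]; first by rewrite mul0r sin0 cos0 expr1n.
  have -> : k.+1%:R * pi = k%:R * pi + pi :> R by rewrite -natr1 mulrDl mul1r.
  by rewrite sinDpi cosDpi IHs oppr0 sqrrN.
case: n => k; first exact: H.
by rewrite NegzE mulrNz mulNr sinN cosN; have [-> ->] := H k.+1; rewrite oppr0.
Qed.

Lemma sin0_int (t : R) : sin t = 0 -> t / pi \is a Num.int.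
Proof.
move=> st; have p0 := pi_gt0 R.
(* Reduce modulo [pi] to the interval where sine has no other zero. *)
pose n := Num.floor (t / pi); pose r := t - n%:~R * pi.
have [sn cn] := sin_cos_int n.
have /andP[n1 n2] : n%:~R <= t / pi < (n + 1)%:~R by exact: floor_itv.
have r0 : 0 <= r by rewrite subr_ge0 -ler_pdivlMr.
have rp : r < pi.
  move: n2; rewrite intrD ltr_pdivrMr// mulrDl mul1r /r; lra.
have sr : sin r = 0 by rewrite /r sinB st sn mul0r mulr0 subr0.
have {}r0 : r = 0.
  apply/eqP; rewrite eq_le r0 andbT leNgt; apply/negP => r1.
  by have := sin_gt0_pi (x := r); rewrite sr ltxx r1 rp => /(_ isT).
have -> : t = n%:~R * pi by apply/eqP; rewrite -subr_eq0; apply/eqP.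
by rewrite mulfK ?gt_eqF// intr_int.
Qed.

End real_trigonometry.

(** * Derivatives and Schwartz functions in real form *)

(** A quadratic remainder gives differentiability in the sense of Frechet
    directly; having all partial derivatives would not be enough. *)
Lemma diff_quad (R : realType) (V W : normedModType R) (f : V -> W)
    (df : {linear V -> W}) (x : V) (K : R) :
  continuous df ->
  (forall h : V, `|f (x + h) - f x - df h| <= K * `|h| ^+ 2) ->
  differentiable f x /\ 'd f x = df :> (V -> W).
Proof.
move=> cdf H.
have K0 : 0 <= `|K| + 1 by rewrite addr_ge0.
have E : f \o shift x = cst (f x) + df +o_ 0 id.
  apply/eqaddoP => e e0; near=> h; rewrite !fctE /= [h + x]addrC opprD addrA.
  rewrite (le_trans (H h))//.
  apply: (@le_trans _ _ ((`|K| + 1) * `|h| ^+ 2)).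
    by rewrite ler_wpM2r ?exprn_ge0// (le_trans (ler_norm _))// lerDl.
  rewrite expr2 mulrA ler_wpM2r// -ler_pdivlMl ?ltr_wpDl// mulrC.
  by near: h; apply: nbhs0_le; rewrite divr_gt0 // ltr_wpDl.
have D : 'd f x = df :> (V -> W) by exact: diff_unique E.
by split => //; apply/diff_locallyP; rewrite D.
Unshelve. all: by end_near. Qed.

Section calculus.
Context {R : realType} {d : nat}.
Local Notation V := 'cV[R]_d.
Implicit Types (f g h : V -> R) (B : set (V -> R)).

(** [pderiv] with a single index; iterated derivatives are generated by it. *)
Definition pd (j : 'I_d) h : V -> R := fun x => 'D_(evec j) h x.

Lemma coord_norm (x : V) i : `|x i 0| <= `|x|.
Proof. by rewrite [leRHS]/Num.norm /= mx_normrE (le_bigmax _ (fun ij => `|x ij.1 ij.2|) (i, 0)). Qed.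

Definition l1norm (a : V) : R := \sum_i `|a i 0|.

Lemma norm_le_l1norm (a : V) : `|a| <= l1norm a.
Proof.
rewrite [leLHS]/Num.norm /= mx_normrE; apply/bigmax_leP; split.
  by apply: sumr_ge0.
move=> [i j] _ /=; rewrite ord1 /l1norm (bigD1 i)//= lerDl.
exact: sumr_ge0.
Qed.

Lemma dot_norm (a x : V) : `|dot a x| <= l1norm a * `|x|.
Proof.
rewrite /dot /l1norm mulr_suml (le_trans (ler_norm_sum _ _ _))//.
by apply: ler_sum => i _; rewrite normrM ler_wpM2l// coord_norm.
Qed.

Lemma dotC (a x : V) : dot a x = dot x a.
Proof. by apply: eq_bigr => i _; rewrite mulrC. Qed.

Lemma dotDr (a x y : V) : dot a (x + y) = dot a x + dot a y.
Proof. by rewrite -big_split; apply: eq_bigr => i _; rewrite mxE mulrDr. Qed.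

Lemma dotZr (a x : V) c : dot a (c *: x) = c * dot a x.
Proof. by rewrite mulr_sumr; apply: eq_bigr => i _; rewrite mxE mulrCA. Qed.

Lemma dot_evec (a : V) j : dot a (evec j) = a j 0.
Proof.
rewrite /dot (bigD1 j)//= mxE !eqxx mulr1 big1 ?addr0// => i ij.
by rewrite mxE (negbTE ij) mulr0.
Qed.

Lemma dotNr (a x : V) : dot a (- x) = - dot a x.
Proof. by rewrite -scaleN1r dotZr mulN1r. Qed.

Lemma dotNl (a x : V) : dot (- a) x = - dot a x.
Proof. by rewrite dotC dotNr dotC. Qed.

Lemma dotDl (a x y : V) : dot (x + y) a = dot x a + dot y a.
Proof. by rewrite dotC dotDr !(dotC a). Qed.

Lemma dot_linear (c : V) : linear (dot c).
Proof. by move=> a x y; rewrite dotDr dotZr. Qed.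
HB.instance Definition _ (c : V) := GRing.isLinear.Build R V R _ (dot c) (dot_linear c).

Lemma continuous_dot (c : V) : continuous (dot c).
Proof.
move=> x; apply/(@cvgrPdist_le _ R^o _ (nbhs x)) => e e0.
have n0 : 0 < l1norm c + 1 by rewrite ltr_wpDl// sumr_ge0.
near=> y.
rewrite -dotNr -dotDr (le_trans (dot_norm _ _))//.
rewrite (@le_trans _ _ ((l1norm c + 1) * `|x - y|)) ?ler_wpM2r ?lerDl//.
rewrite -ler_pdivlMl// mulrC.
near: y.
have /cvgr_dist_le := @cvg_id _ (nbhs x); apply; by rewrite divr_gt0.
Unshelve. all: by end_near. Qed.

Lemma differentiable_quad f (x c : V) (K : R) :
  (forall h : V, `|f (x + h) - f x - dot c h| <= K * `|h| ^+ 2) ->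
  differentiable f x /\ forall v, 'D_v f x = dot c v.
Proof.
move=> H; have [D E] := @diff_quad _ V R^o f (dot c) x K (@continuous_dot c) H.
by split => // v; rewrite deriveE// E.
Qed.

(** All iterated partial derivatives exist and satisfy [B].  [jets decays] is
    the real form of the Schwartz space, [jets grows] the algebra of its smooth
    multipliers of polynomial growth. *)
Definition jets B g := forall l,
  (forall x, differentiable (pderiv l g) x) /\ B (pderiv l g).

Definition decays : set (V -> R) := fun h =>
  forall N : nat, exists K, forall x, (1 + `|x|) ^+ N * `|h x| <= K.

Definition grows : set (V -> R) := fun h =>
  exists (N : nat) (K : R), forall x, `|h x| <= K * (1 + `|x|) ^+ N.

(** A class of functions closed under partial derivatives has all its members
    smooth; this replaces the Leibniz formula for iterated derivatives by a
    closure property. *)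
Lemma jets_coind B (C : set (V -> R)) :
  (forall h, C h -> (forall x, differentiable h x) /\ B h) ->
  (forall h j, C h -> C (pd j h)) ->
  forall h, C h -> jets B h.
Proof.
move=> CB Cpd h Ch l.
suff : C (pderiv l h) by exact: CB.
by elim: l => //= j l; exact: Cpd.
Qed.

Lemma jets_diff B h x : jets B h -> differentiable h x.
Proof. by move=> /(_ [::])[]. Qed.

Lemma jets_val B h : jets B h -> B h.
Proof. by move=> /(_ [::])[]. Qed.

Lemma jets_pd B h j : jets B h -> jets B (pd j h).
Proof.
move=> hB l; suff -> : pderiv l (pd j h) = pderiv (rcons l j) h by exact: hB.
by elim: l {hB} => //= i l ->.
Qed.

Lemma pdD f g j : (forall x, differentiable f x) -> (forall x, differentiable g x) ->
  pd j (fun x => f x + g x) = fun x => pd j f x + pd j g x.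
Proof. by move=> df dg; apply/funext => x; rewrite /pd deriveD//; exact: diff_derivable. Qed.

Lemma pdM f g j : (forall x, differentiable f x) -> (forall x, differentiable g x) ->
  pd j (fun x => f x * g x) = fun x => pd j f x * g x + f x * pd j g x.
Proof.
move=> df dg; apply/funext => x; rewrite /pd deriveM; do 1?exact: diff_derivable.
by rewrite addrC; congr (_ + _); exact: mulrC.
Qed.

(** The closure of products under the Leibniz rule. *)
Inductive sums_of_products (B1 B2 : set (V -> R)) : set (V -> R) :=
| Sum_product f g : B1 f -> B2 g -> sums_of_products B1 B2 (fun x => f x * g x)
| Sum_sum f g : sums_of_products B1 B2 f -> sums_of_products B1 B2 g ->
    sums_of_products B1 B2 (fun x => f x + g x).

Lemma jetsM B1 B2 B f g :
  (forall h1 h2, B h1 -> B h2 -> B (fun x => h1 x + h2 x)) ->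
  (forall h1 h2, B1 h1 -> B2 h2 -> B (fun x => h1 x * h2 x)) ->
  jets B1 f -> jets B2 g -> jets B (fun x => f x * g x).
Proof.
move=> BD BM fB gB; pose C := sums_of_products (jets B1) (jets B2).
have CB h : C h -> (forall x, differentiable h x) /\ B h.
  elim=> {h} [h1 h2 h1B h2B|h1 h2 _ [d1 b1] _ [d2 b2]].
    split; last by apply: BM; apply: jets_val.
    by move=> x; apply: differentiableM; [exact: jets_diff h1B|exact: jets_diff h2B].
  by split; [move=> x; exact: differentiableD|exact: BD].
apply: (@jets_coind B C) => //; last by constructor.
move=> h j; elim=> {h} [h1 h2 h1B h2B|h1 h2 C1 C1' C2 C2'].
  rewrite (pdM _ (fun x => jets_diff x h1B) (fun x => jets_diff x h2B)).
  by apply: Sum_sum; apply: Sum_product => //; exact: jets_pd.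
by rewrite (pdD _ (CB _ C1).1 (CB _ C2).1); exact: Sum_sum.
Qed.

Lemma jetsD B f g :
  (forall h1 h2, B h1 -> B h2 -> B (fun x => h1 x + h2 x)) ->
  jets B f -> jets B g -> jets B (fun x => f x + g x).
Proof.
move=> BD fB gB.
apply: (@jets_coind B [set h | exists2 p, jets B p.1 /\ jets B p.2 &
    h = fun x => p.1 x + p.2 x]); last by exists (f, g).
- move=> _ [[h1 h2] /= [h1B h2B] ->]; split; last by apply: BD; exact: jets_val.
  by move=> x; apply: differentiableD; [exact: jets_diff h1B|exact: jets_diff h2B].
- move=> _ j [[h1 h2] /= [h1B h2B] ->]; exists (pd j h1, pd j h2) => /=.
    by split; exact: jets_pd.
  by rewrite (pdD _ (fun x => jets_diff x h1B) (fun x => jets_diff x h2B)).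
Qed.

Lemma weight_ge1 (x : V) : 1 <= 1 + `|x|. Proof. by rewrite lerDl. Qed.
Lemma weight_gt0 (x : V) : 0 < 1 + `|x|. Proof. by rewrite ltr_pwDl. Qed.
Hint Resolve weight_ge1 weight_gt0 : core.
Lemma weight_ge0 (x : V) : 0 <= 1 + `|x|. Proof. exact/ltW. Qed.
Hint Resolve weight_ge0 : core.

Lemma decaysD h1 h2 : decays h1 -> decays h2 -> decays (fun x => h1 x + h2 x).
Proof.
move=> b1 b2 N; have [K1 H1] := b1 N; have [K2 H2] := b2 N.
exists (K1 + K2) => x; apply: le_trans (lerD (H1 x) (H2 x)).
by rewrite -mulrDr ler_wpM2l ?exprn_ge0 ?ler_normD.
Qed.

Lemma growsM_decays h1 h2 : grows h1 -> decays h2 -> decays (fun x => h1 x * h2 x).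
Proof.
move=> [M [K1 H1]] b2 N; have [K2 H2] := b2 (N + M)%N.
have K10 : 0 <= K1 by have := le_trans (normr_ge0 _) (H1 0); rewrite pmulr_lge0// exprn_gt0.
exists (K1 * K2) => x; rewrite normrM.
apply: le_trans (ler_wpM2l K10 (H2 x)).
rewrite exprD -mulrA [leRHS]mulrCA ler_wpM2l ?exprn_ge0//.
by rewrite mulrA ler_wpM2r.
Qed.

Local Notation sch := (jets decays).

Lemma schD f g : sch f -> sch g -> sch (fun x => f x + g x).
Proof. exact/jetsD/decaysD. Qed.

Lemma schM f g : jets grows f -> sch g -> sch (fun x => f x * g x).
Proof. by apply: jetsM; [exact: decaysD|exact: growsM_decays]. Qed.

Lemma grows_cst c : jets grows (cst c).
Proof.
apply: (@jets_coind grows [set h | exists c, h = cst c]); last by exists c.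
- move=> _ [a ->]; split; first by move=> x; exact: differentiable_cst.
  by exists 0%N, `|a| => x; rewrite expr0 mulr1.
- move=> _ j [a ->]; exists 0; apply/funext => x; exact: derive_cst.
Qed.

Lemma grows_dot a : jets grows (dot a).
Proof.
have D x : differentiable (dot a) x /\ forall v, 'D_v (dot a) x = dot a v.
  apply: (@differentiable_quad (dot a) x a 0) => h.
  have -> : dot a (x + h) - dot a x - dot a h = 0 by rewrite dotDr; ring.
  by rewrite normr0 mul0r.
move=> l; case: (lastP l) => [|{}l j].
  split; first by move=> x; exact: (D x).1.
  exists 1%N, (l1norm a) => x; apply: le_trans (dot_norm _ _) _.
  by rewrite ler_wpM2l ?expr1 ?lerDr// sumr_ge0.
have -> : pderiv (rcons l j) (dot a) = pderiv l (pd j (dot a)).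
  by elim: l {D} => //= i l ->.
have -> : pd j (dot a) = cst (a j 0) by apply/funext => x; rewrite /pd (D x).2 dot_evec.
exact: grows_cst.
Qed.

(** A plane wave with phase [t]: the phases 0 and [- pi / 2] give the cosine
    and the sine of [dot a x]. *)
Definition wave (a : V) (t : R) : V -> R := fun x => cos (dot a x + t).

Lemma diff_wave a t x : differentiable (wave a t) x /\
  forall v, 'D_v (wave a t) x = wave a (t + pi / 2) x * dot a v.
Proof.
have [|D E] := @differentiable_quad (wave a t) x (wave a (t + pi / 2) x *: a)
    (l1norm a ^+ 2).
  move=> h; have -> : dot (wave a (t + pi / 2) x *: a) h = dot a h * wave a (t + pi / 2) x.
    by rewrite dotC dotZr dotC mulrC.
  rewrite /wave.
  have -> : dot a (x + h) + t = dot a x + t + dot a h by rewrite dotDr; ring.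
  rewrite addrA; apply: le_trans (taylor_cos _ _) _.
  rewrite -exprMn -ler_sqrt ?sqr_ge0// !sqrtr_sqr.
  by rewrite [leRHS]ger0_norm ?dot_norm// mulr_ge0// sumr_ge0.
by split => // v; rewrite E dotC dotZr dotC.
Qed.

Lemma pd_wave a t j : pd j (wave a t) = fun x => a j 0 * wave a (t + pi / 2) x.
Proof. by apply/funext => x; rewrite /pd (diff_wave _ _ _).2 dot_evec mulrC. Qed.

Lemma grows_wave a t : jets grows (wave a t).
Proof.
apply: (@jets_coind grows [set h | exists p : R * R, h = fun x => p.1 * wave a p.2 x]).
- move=> _ [[c s] /= ->]; split.
    by move=> x; apply: differentiableM; [exact: differentiable_cst|exact: (diff_wave _ _ _).1].
  exists 0%N, `|c| => x; rewrite expr0 mulr1 normrM ler_piMr//.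
  by rewrite ler_norml cos_geN1 cos_le1.
- move=> _ j [[c s] /= ->]; exists (c * a j 0, s + pi / 2) => /=.
  apply/funext => x; rewrite /pd deriveMl ?mulrA.
    by rewrite (diff_wave _ _ _).2 dot_evec mulrA mulrAC.
  exact/diff_derivable/(diff_wave _ _ _).1.
- by exists (1, t); apply/funext => x /=; rewrite mul1r.
Qed.

Lemma pd_shift g a j : pd j (fun x => g (x + a)) = fun x => pd j g (x + a).
Proof.
apply/funext => x; rewrite /pd /derive; congr lim.
have -> // : (fun t : R => t^-1 *: (((fun x => g (x + a)) \o shift x) (t *: evec j) - g (x + a)))
  = (fun t : R => t^-1 *: ((g \o shift (x + a)) (t *: evec j) - g (x + a))).
by apply/funext => t /=; rewrite addrA.
Qed.

Lemma sch_shift g a : sch g -> sch (fun x => g (x + a)).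
Proof.
move=> gS; apply: (@jets_coind decays [set h | exists2 f, sch f & h = fun x => f (x + a)]).
- move=> _ [f fS ->]; split.
    move=> x; apply: (@differentiable_comp _ _ _ _ (fun x => x + a) f); last exact: jets_diff fS.
    by apply: differentiableD; [exact: ex_diff|exact: differentiable_cst].
  move=> N; have [K H] := jets_val fS N.
  exists ((1 + `|a|) ^+ N * K) => x.
  apply: le_trans (ler_wpM2l _ (H (x + a))); last by rewrite exprn_ge0.
  rewrite mulrA ler_wpM2r// -exprMn lerXn2r ?nnegrE ?mulr_ge0//.
  have : `|x| <= `|x + a| + `|a| by rewrite -[X in `|X| <= _](addrK a) ler_normB.
  have := normr_ge0 (x + a); have := normr_ge0 a; nra.
- by move=> _ j [f fS ->]; exists (pd j f); [exact: jets_pd|rewrite pd_shift].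
- by exists g.
Qed.

End calculus.

Section complex_schwartz.
Context {R : realType}.
Lemma cmodE (z : R[i]) : cmod z = Num.sqrt (complex.Re z ^+ 2 + complex.Im z ^+ 2).
Proof. by case: z. Qed.
Lemma Re_cmod (z : R[i]) : `|complex.Re z| <= cmod z.
Proof. by rewrite cmodE -sqrtr_sqr ler_wsqrtr// lerDl sqr_ge0. Qed.
Lemma Im_cmod (z : R[i]) : `|complex.Im z| <= cmod z.
Proof. by rewrite cmodE -sqrtr_sqr ler_wsqrtr// lerDr sqr_ge0. Qed.
Lemma cmod_Re_Im (z : R[i]) : cmod z <= `|complex.Re z| + `|complex.Im z|.
Proof.
rewrite cmodE -[leRHS]ger0_norm ?addr_ge0// -sqrtr_sqr ler_wsqrtr//.
rewrite sqrrD !real_normK ?num_real// lerD2r lerDl mulrn_wge0 ?mulr_ge0//.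
Qed.
Context {d : nat}.
Local Notation V := 'cV[R]_d.
(** The real and imaginary parts are treated separately, because the
    derivatives of complex-valued functions are defined through them. *)
Lemma schwartzP (f : V -> R[i]) : schwartz f <->
  jets decays (Re_fun f) /\ jets decays (Im_fun f).
Proof.
split=> [[sf bf]|[rf jf]].
  split=> l; (split; first by move=> x; have [] := sf l x) => N;
    have [K HK] := bf N l; exists K => x; apply: le_trans (HK x);
    rewrite ler_wpM2l ?exprn_ge0 ?addr_ge0//.
  - exact: (Re_cmod (cpderiv l f x)).
  - exact: (Im_cmod (cpderiv l f x)).
split=> [l x|N l]; first by split; [exact: (rf l).1|exact: (jf l).1].
have [K1 H1] := (rf l).2 N; have [K2 H2] := (jf l).2 N.
exists (K1 + K2) => x; apply: le_trans (lerD (H1 x) (H2 x)).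
by rewrite -mulrDr ler_wpM2l ?exprn_ge0 ?addr_ge0 ?cmod_Re_Im.
Qed.
End complex_schwartz.

(** * Lebesgue measure on tuples *)

Section lebesgue_tuple.
Context {R : realType}.

Definition tshift n (a : 'I_n -> R) (t : n.-tuple (measurableTypeR R)) :
  n.-tuple (measurableTypeR R) := [tuple (tnth t i : R) + a i | i < n].

Lemma measurable_shift (a : R) :
  measurable_fun setT ((fun x => x + a) : measurableTypeR R -> measurableTypeR R).
Proof. exact: measurable_funD. Qed.

Lemma measurable_tshift n (a : 'I_n -> R) : measurable_fun setT (tshift a).
Proof.
apply/measurable_fun_tnthP => i.
apply: (eq_measurable_fun (fun t : n.-tuple (measurableTypeR R) => (tnth t i : R) + a i)).
  by move=> t _ /=; rewrite tnth_mktuple.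
apply: measurable_funD => //; exact: measurable_tnth.
Qed.

Lemma lebesgue_measure_shift (a : R) (E : set (measurableTypeR R)) :
  measurable E -> lebesgue_measure ((fun x => x + a) @^-1` E) = lebesgue_measure E.
Proof.
move=> mE.
pose mu := measure_function_pushforward__canonical__measure_function_Measure
  (@lebesgue_measure R) (measurable_shift a).
apply/esym; apply: (@lebesgue_measure_unique R mu) => // X.
move=> /ocitvP[->|[[u v] /= uv ->]]; first by rewrite !measure0.
rewrite /mu /= /pushforward.
have -> : (fun x : R => x + a) @^-1` `]u, v]%classic = `](u - a), (v - a)]%classic.
  by apply/seteqP; split => x; rewrite /= !in_itv/= ltrBlDr lerBrDr.
by rewrite !lebesgue_measure_itv /= !lte_fin ltrD2r uv -!EFinB opprB addrA subrK.
Qed.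

(** By induction on the dimension: on [R * R^n] the image of the product
    measure under a translation agrees with the product measure on rectangles.
    *)
Lemma lebesgue_tuple_shift n (a : 'I_n -> R) (E : set (n.-tuple (measurableTypeR R))) :
  measurable E -> lebesgue_tuple R n (tshift a @^-1` E) = lebesgue_tuple R n E.
Proof.
elim: n a E => [|n IHn] a E mE.
  congr (lebesgue_tuple R 0 _); apply/funext => t; congr E; by apply: eq_from_tnth => -[].
pose a' i := a (lift ord0 i).
pose phi (p : measurableTypeR R * n.-tuple (measurableTypeR R)) :
  measurableTypeR R * n.-tuple (measurableTypeR R) := ((p.1 : R) + a ord0, tshift a' p.2).
have mphi : measurable_fun setT phi.
  apply/measurable_fun_pairP; split.
    exact: (measurableT_comp (measurable_shift (a ord0)) measurable_fst).
  exact: (measurableT_comp (measurable_tshift (n:=n) a') measurable_snd).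
pose mu := measure_function_pushforward__canonical__measure_function_Measure
  (lebesgue_measure \x lebesgue_tuple R n)%E mphi.
rewrite /= /lebesgue_cons /pushforward.
have -> : @tcons R n @^-1` (tshift a @^-1` E) = phi @^-1` (@tcons R n @^-1` E).
  apply/funext => -[x t]; congr E; apply: eq_from_tnth => i; rewrite tnth_mktuple.
  by case: (unliftP ord0 i) => [j ->|->]; rewrite ?tnthS ?tnth0// tnth_mktuple.
apply/esym; apply: (@product_measure_unique _ _ _ _ R lebesgue_measure (lebesgue_tuple R n) mu).
  move=> A B mA mB; rewrite /mu /= /pushforward.
  have -> : phi @^-1` (A `*` B) = ((fun x => x + a ord0) @^-1` A) `*` (tshift a' @^-1` B) by [].
  have mA' : measurable ((fun x => x + a ord0) @^-1` A).
    by rewrite -[X in measurable X]setTI; exact: measurable_shift.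
  have mB' : measurable (tshift a' @^-1` B).
    by rewrite -[X in measurable X]setTI; exact: measurable_tshift.
  rewrite (product_measure1E lebesgue_measure (lebesgue_tuple R n) mA' mB') IHn//.
  by congr (_ * _)%E; exact: lebesgue_measure_shift.
by rewrite -[X in measurable X]setTI; exact: measurable_tcons.
Qed.

Lemma integral_oneDsqrV : (\int[lebesgue_measure]_x ((oneDsqr (x : R))^-1)%:E = pi%:E)%E.
Proof.
rewrite ge0_symfun_integralT.
- have -> : [set x : R | 0 <= x] = `[0%R, +oo[%classic by rewrite set_itvcy.
  by rewrite integral0y_oneDsqr -EFinM mulrC divfK.
- by move=> x; rewrite invr_ge0 addr_ge0// sqr_ge0.
- exact: continuous_oneDsqrV.
- by move=> x /=; rewrite /oneDsqr sqrrN.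
Qed.

(** The product of the one-dimensional densities [1 / (1 + x ^ 2)], whose
    integrals are computed coordinate by coordinate. *)
Definition cauchy_weight n (t : n.-tuple (measurableTypeR R)) : R :=
  \prod_(i < n) (oneDsqr (tnth t i : R))^-1.

Lemma cauchy_weight_ge0 n t : 0 <= @cauchy_weight n t.
Proof. by apply: prodr_ge0 => i _; rewrite invr_ge0 addr_ge0// sqr_ge0. Qed.

Lemma measurable_cauchy_weight n : measurable_fun setT (@cauchy_weight n).
Proof.
apply: measurable_prod => i _.
apply: (@measurableT_comp _ _ _ _ _ _ (fun x : R => (oneDsqr x)^-1)); last exact: measurable_tnth.
by apply: continuous_measurable_fun; exact: continuous_oneDsqrV.
Qed.

Lemma measurable_cauchy_weightE n :
  measurable_fun setT (fun t => (@cauchy_weight n t)%:E).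
Proof. by apply/measurable_EFinP; exact: measurable_cauchy_weight. Qed.

Lemma integral_cauchy_weight n :
  (\int[lebesgue_tuple R n]_t (cauchy_weight t)%:E = (pi ^+ n)%:E)%E.
Proof.
elim: n => [|n IHn].
  rewrite /= integral_dirac//; last exact: measurable_cauchy_weightE.
  by rewrite diracT mul1e /cauchy_weight big_ord0.
rewrite /= /lebesgue_cons ge0_integral_pushforward//; first last.
- by move=> t _; rewrite lee_fin cauchy_weight_ge0.
- exact: measurable_cauchy_weightE.
- exact: measurable_tcons.
rewrite preimage_setT fubini_tonelli1; first last.
- by move=> t; rewrite lee_fin cauchy_weight_ge0.
- exact: (measurableT_comp (@measurable_cauchy_weightE n.+1) (@measurable_tcons R n)).
rewrite /fubini_F /=.
transitivity (\int[lebesgue_measure]_x ((pi ^+ n)%:E * ((oneDsqr (x : R))^-1)%:E))%E; last first.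
  rewrite ge0_integralZl//.
  - by rewrite integral_oneDsqrV -EFinM exprSr.
  - by apply/measurable_EFinP; apply: continuous_measurable_fun; exact: continuous_oneDsqrV.
  - by rewrite lee_fin exprn_ge0// pi_ge0.
apply: eq_integral => x _; rewrite muleC -IHn -ge0_integralZl//.
- apply: eq_integral => t _; rewrite -EFinM /cauchy_weight big_ord_recl tnth0.
  by under eq_bigr do rewrite tnthS.
- exact: measurable_cauchy_weightE.
- by move=> t _; rewrite lee_fin cauchy_weight_ge0.
Qed.

Lemma integrable_cauchy_weight n :
  (lebesgue_tuple R n).-integrable setT (EFin \o @cauchy_weight n).
Proof.
apply/integrableP; split; first exact: measurable_cauchy_weightE.
under eq_integral do rewrite /= ger0_norm ?cauchy_weight_ge0//.
by rewrite integral_cauchy_weight ltry.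
Qed.

End lebesgue_tuple.

(** * Integration over column vectors *)

Section integration.
Context {R : realType} {d : nat}.
Local Notation V := 'cV[R]_d.
Local Notation T := (d.-tuple (measurableTypeR R)).
Local Notation mu := (lebesgue_tuple R d).

Lemma norm_le_coord (x : V) (K : R) : 0 <= K -> (forall i, `|x i 0| <= K) -> `|x| <= K.
Proof.
move=> K0 H; rewrite [leLHS]/Num.norm /= mx_normrE; apply/bigmax_leP; split => //.
by move=> [i j] _ /=; rewrite ord1.
Qed.

(** The measurable sets of tuples are generated by coordinates; an open set is
    a countable union of boxes with rational centre and radius. *)
Lemma measurable_open_col (O : set V) : open O ->
  measurable (col_of_tuple @^-1` O : set T).
Proof.
move=> oO.
pose box (q : {ffun 'I_d -> rat} * rat) : set T :=
  [set t | forall i, `](ratr (q.1 i) - ratr q.2), (ratr (q.1 i) + ratr q.2)[%classic (tnth t i : R)].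
pose F q := if `[< box q `<=` col_of_tuple @^-1` O >] then box q else set0.
have -> : col_of_tuple @^-1` O = \bigcup_q F q.
  apply/seteqP; split=> [t Ot|t [q _]]; last first.
    by rewrite /F; case: asboolP => // H /H.
  have /nbhs_ballP[e /= e0 He] := oO _ Ot.
  have [r] : exists q : rat, ratr q \in `](0 : R), (e / 2)[ by apply: rat_in_itvoo; rewrite divr_gt0.
  rewrite in_itv /= => /andP[r0 re].
  have [c Hc] : exists c : {ffun 'I_d -> rat}, forall i,
      ratr (c i) \in `]((tnth t i : R) - ratr r), ((tnth t i : R) + ratr r)[.
    have P i : exists q : rat, ratr q \in `]((tnth t i : R) - ratr r), ((tnth t i : R) + ratr r)[.
      by apply: rat_in_itvoo; rewrite ltrBlDr -addrA ltrDl addr_gt0.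
    by exists [ffun i => projT1 (cid (P i))] => i; rewrite ffunE; case: cid.
  exists (c, r) => //; rewrite /F; case: asboolP => [_ i|].
    by have := Hc i; rewrite /= !in_itv /= => /andP[]; lra.
  case=> s /= Hs; apply: He; rewrite -ball_normE /=.
  apply: (@le_lt_trans _ _ (2 * ratr r)); last by lra.
  apply: norm_le_coord => [|i]; first by rewrite mulr_ge0 ?ltW.
  rewrite !mxE ler_norml; have := Hc i; have := Hs i; rewrite /= !in_itv /=; lra.
apply: countable_bigcupT_measurable; first exact: countableP.
move=> q; rewrite /F; case: asboolP => _ //.
apply: (lebesgue_tuple_box (A := fun i =>
  `](ratr (q.1 i) - ratr q.2), (ratr (q.1 i) + ratr q.2)[%classic) _).1 => i.
exact: measurable_itv.
Qed.

Lemma measurable_continuous_col (g : V -> R) : continuous g ->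
  measurable_fun setT (g \o col_of_tuple : T -> R).
Proof.
move=> /continuousP cg; apply: (measurability _ (RGenOpens.measurableE R)).
move=> _ [_ [a [b ->] <-]]; rewrite setTI comp_preimage.
by apply: measurable_open_col; apply/cg/interval_open.
Qed.

Definition integrableV (g : V -> R) := mu.-integrable setT (EFin \o (g \o col_of_tuple)).
Definition integralV (g : V -> R) : R := \int[mu]_t g (col_of_tuple t).

(** The weight [(1 + |x|) ^ (2 d)] dominates [prod_i (1 + x_i ^ 2)]; hence [2 *
    d] is an exponent of decay that ensures integrability. *)
Lemma weight_cauchy (t : T) :
  1 <= (1 + `|col_of_tuple t|) ^+ (2 * d) * cauchy_weight t.
Proof.
rewrite exprM -[X in _ ^+ X]card_ord -prodr_const -big_split /=.
have E1 : 1 = \prod_(i < d) (1 : R) by rewrite big1.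
rewrite [leLHS]E1.
apply: ler_prod => i _; rewrite ler01 /= ler_pdivlMr ?mul1r; last first.
  by rewrite ltr_wpDr ?sqr_ge0.
have := coord_norm (col_of_tuple t) i; rewrite mxE => H.
rewrite /oneDsqr -real_normK ?num_real//.
have := normr_ge0 (tnth t i : R); nra.
Qed.

Lemma integrableV_dominated (g : V -> R) K :
  measurable_fun setT (g \o col_of_tuple : T -> R) ->
  (forall x, (1 + `|x|) ^+ (2 * d) * `|g x| <= K) -> integrableV g.
Proof.
move=> mg H.
apply: (@le_integrable _ _ _ _ _ measurableT _ (fun t => (K * cauchy_weight t)%:E)).
- exact/measurable_EFinP.
- move=> t _; rewrite lee_fin.
  have w0 := cauchy_weight_ge0 t.
  apply: le_trans (ler_norm _).
  apply: le_trans (ler_wpM2r w0 (H (col_of_tuple t))).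
  rewrite mulrAC ler_peMl//=; exact: weight_cauchy.
- under eq_fun do rewrite EFinM.
  by apply: integrableZl => //; exact: integrable_cauchy_weight.
Qed.

Lemma col_tshift (a : V) (t : T) : col_of_tuple (tshift (fun i => a i 0) t) = col_of_tuple t + a.
Proof. by apply/colP => i; rewrite !mxE tnth_mktuple. Qed.

Lemma integralV_shift (g : V -> R) (a : V) :
  integrableV g -> integrableV (fun x => g (x + a)) -> integralV (fun x => g (x + a)) = integralV g.
Proof.
move=> ig iga; rewrite /integralV /Rintegral; congr fine.
pose s : T -> T := tshift (fun i => a i 0).
pose nu := measure_function_pushforward__canonical__measure_function_Measure
  mu (measurable_tshift (fun i => a i 0)).
have E : (g \o col_of_tuple) \o s = (fun x => g (x + a)) \o col_of_tuple.
  by apply/funext => t /=; rewrite /s col_tshift.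
transitivity (\int[pushforward mu s]_t (g (col_of_tuple t))%:E)%E.
  rewrite integral_pushforward//.
  - by apply: eq_integral => t _ /=; rewrite col_tshift.
  - exact: measurable_tshift.
  - by case/integrableP : ig.
  - by rewrite preimage_setT /integrableV -E in iga *.
apply: (@eq_measure_integral _ _ _ _ mu nu) => A mA _.
exact: lebesgue_tuple_shift.
Qed.

End integration.

(** * The Fourier transform of a Schwartz function *)

Section oscillatory.
Context {R : realType} {d : nat}.
Local Notation V := 'cV[R]_d.
Local Notation T := (d.-tuple (measurableTypeR R)).
Local Notation mu := (lebesgue_tuple R d).
Local Notation sch := (jets decays).
Implicit Types (f g h : V -> R).

Lemma integrableVD f g : integrableV f -> integrableV g -> integrableV (fun x => f x + g x).
Proof.
move=> fi gi; rewrite /integrableV.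
have -> : EFin \o ((fun x => f x + g x) \o col_of_tuple) =
  (EFin \o (f \o col_of_tuple)) \+ (EFin \o (g \o @col_of_tuple R d)) by [].
exact: integrableD.
Qed.

Lemma integrableVZ (c : R) f : integrableV f -> integrableV (fun x => c * f x).
Proof. by move=> fi; apply: (@integrableZl _ _ _ _ _ measurableT c _ fi). Qed.

Lemma integralVD f g : integrableV f -> integrableV g -> integralV (fun x => f x + g x) = integralV f + integralV g.
Proof. by move=> fi gi; exact: RintegralD. Qed.

Lemma integralVZ c f : integrableV f -> integralV (fun x => c * f x) = c * integralV f.
Proof. by move=> fi; rewrite /integralV RintegralZl. Qed.

Lemma integralVB f g : integrableV f -> integrableV g -> integralV (fun x => f x - g x) = integralV f - integralV g.
Proof. by move=> fi gi; exact: RintegralB. Qed.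

Lemma integralV_sum (I : Type) (s : seq I) (F : I -> V -> R) : (forall i, integrableV (F i)) ->
  integrableV (fun x => \sum_(i <- s) F i x) /\
  integralV (fun x => \sum_(i <- s) F i x) = \sum_(i <- s) integralV (F i).
Proof.
move=> Fi; elim: s => [|i s [IH1 IH2]].
  have -> : (fun x => \sum_(i <- [::]) F i x) = (fun _ => 0 * 0 : R).
    by apply/funext => x; rewrite big_nil mul0r.
  have i0 : integrableV (fun _ : V => 0 : R) by exact: integrable0.
  by split; [exact: integrableVZ|rewrite integralVZ// mul0r big_nil].
have -> : (fun x => \sum_(j <- i :: s) F j x) = (fun x => F i x + \sum_(j <- s) F j x).
  by apply/funext => x; rewrite big_cons.
by split; [exact: integrableVD|rewrite integralVD// IH2 big_cons].
Qed.

(** The constant [pi ^ d] is the integral of [cauchy_weight]. *)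
Lemma integralV_bound f K : measurable_fun setT (f \o col_of_tuple : T -> R) ->
  (forall x, (1 + `|x|) ^+ (2 * d) * `|f x| <= K) -> `|integralV f| <= K * pi ^+ d.
Proof.
move=> mf H; have fi := integrableV_dominated mf H.
apply: le_trans (le_normr_Rintegral measurableT fi) _.
have -> : K * pi ^+ d = \int[mu]_t (K * cauchy_weight t).
  rewrite RintegralZl//; last exact: integrable_cauchy_weight.
  by rewrite /Rintegral integral_cauchy_weight.
apply: le_Rintegral => //.
- exact: (integrable_abse fi).
- by apply: (@integrableZl _ _ _ _ _ measurableT K _ (integrable_cauchy_weight d)).
- move=> t _ /=; apply: le_trans (ler_wpM2r (cauchy_weight_ge0 t) (H (col_of_tuple t))).
  rewrite mulrAC ler_peMl//=; exact: weight_cauchy.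
Qed.

Lemma sch_continuous g : sch g -> continuous g.
Proof. by move=> gS x; apply: differentiable_continuous; exact: jets_diff gS. Qed.

Lemma sch_measurable g : sch g -> measurable_fun setT (g \o col_of_tuple : T -> R).
Proof. by move=> gS; apply: measurable_continuous_col; exact: sch_continuous. Qed.

Lemma sch_integrableV g : sch g -> integrableV g.
Proof.
move=> gS; have [K H] := jets_val gS (2 * d)%N.
exact: integrableV_dominated (sch_measurable gS) H.
Qed.

Lemma schZ c g : sch g -> sch (fun x => c * g x).
Proof. by move=> gS; exact: (schM (grows_cst c) gS). Qed.

(** The Fourier integral with kernel [cos (xi . x + t)]; up to sign,
    differentiation in [xi] and multiplication by a coordinate of [xi] both
    shift [t] by a quarter turn. *)
Definition cos_transform (t : R) g : V -> R := fun xi => integralV (fun x => g x * wave xi t x).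

Lemma sch_wave t g xi : sch g -> sch (fun x => g x * wave xi t x).
Proof.
move=> gS; have -> : (fun x => g x * wave xi t x) = (fun x => wave xi t x * g x).
  by apply/funext => x; rewrite mulrC.
by apply: schM => //; exact: grows_wave.
Qed.

Definition coord_mul (j : 'I_d) g : V -> R := fun x => x j 0 * g x.

Lemma sch_coord_mul j g : sch g -> sch (coord_mul j g).
Proof.
move=> gS; rewrite /coord_mul; have -> : (fun x : V => x j 0 * g x) = (fun x => dot (evec j) x * g x).
  by apply/funext => x; rewrite dotC dot_evec.
by apply: schM => //; exact: grows_dot.
Qed.

Lemma l1norm_le (h : V) : l1norm h <= d%:R * `|h|.
Proof.
rewrite /l1norm mulr_natl -[X in _ *+ X]card_ord -sumr_const.
by apply: ler_sum => i _; exact: coord_norm.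
Qed.

Lemma wave_taylor (xi h x : V) t :
  `|wave (xi + h) t x - wave xi t x - dot h x * wave xi (t + pi / 2) x| <=
  (d%:R * `|h| * `|x|) ^+ 2.
Proof.
rewrite /wave; have -> : dot (xi + h) x + t = dot xi x + t + dot h x by rewrite dotDl; ring.
rewrite addrA; apply: le_trans (taylor_cos _ _) _.
rewrite -[leLHS]real_normK ?num_real// lerXn2r ?nnegrE ?mulr_ge0//.
by apply: le_trans (dot_norm _ _) _; rewrite ler_wpM2r ?l1norm_le.
Qed.

(** The first order expansion of the kernel is integrated: its remainder is
    quadratic in the increment with a factor [|x| ^ 2], which the decay of [g]
    absorbs. *)
Lemma diff_cos_transform t g xi : sch g -> differentiable (cos_transform t g) xi /\
  forall v, 'D_v (cos_transform t g) xi = dot (\col_j cos_transform (t + pi / 2) (coord_mul j g) xi) v.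
Proof.
move=> gS; have [K HK] := jets_val gS (2 * d + 2)%N.
apply: (@differentiable_quad _ _ _ _ _ (d%:R ^+ 2 * K * pi ^+ d)) => h.
pose rem x := g x * wave (xi + h) t x - g x * wave xi t x -
  \sum_j h j 0 * (coord_mul j g x * wave xi (t + pi / 2) x).
have i1 := sch_integrableV (sch_wave t (xi + h) gS).
have i2 := sch_integrableV (sch_wave t xi gS).
have i3 j : integrableV (fun x => h j 0 * (coord_mul j g x * wave xi (t + pi / 2) x)).
  by apply: integrableVZ; exact/sch_integrableV/sch_wave/sch_coord_mul.
have [i4 E4] := integralV_sum (index_enum 'I_d) i3.
have i12 : integrableV (fun x => g x * wave (xi + h) t x - g x * wave xi t x).
  have -> : (fun x => g x * wave (xi + h) t x - g x * wave xi t x) =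
    (fun x => g x * wave (xi + h) t x + -1 * (g x * wave xi t x)).
    by apply/funext => x; rewrite mulN1r.
  by apply: integrableVD => //; exact: integrableVZ.
have -> : cos_transform t g (xi + h) - cos_transform t g xi - dot (\col_j cos_transform (t + pi / 2) (coord_mul j g) xi) h =
    integralV rem.
  rewrite /rem integralVB// integralVB// E4; congr (_ - _).
  apply: eq_bigr => j _; rewrite mxE mulrC integralVZ//.
  exact/sch_integrableV/sch_wave/sch_coord_mul.
have mrem : measurable_fun setT (rem \o col_of_tuple : T -> R).
  apply: measurable_funB; first by case/integrableP : i12 => /measurable_EFinP.
  by case/integrableP : i4 => /measurable_EFinP.
rewrite mulrAC; apply: integralV_bound => // x.
have -> : rem x = g x * (wave (xi + h) t x - wave xi t x - dot h x * wave xi (t + pi / 2) x).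
  rewrite /rem !mulrBr; congr (_ - _).
  rewrite /dot mulr_suml mulr_sumr; apply: eq_bigr => j _; rewrite /coord_mul; ring.
rewrite normrM mulrA; apply: le_trans (ler_wpM2l _ (wave_taylor _ _ _ _)) _.
  by rewrite mulr_ge0 ?exprn_ge0 ?addr_ge0.
have -> : d%:R ^+ 2 * K * `|h| ^+ 2 = (d%:R * `|h|) ^+ 2 * K by ring.
apply: le_trans (ler_wpM2l (sqr_ge0 _) (HK x)); rewrite exprD exprMn.
have -> : (d%:R * `|h|) ^+ 2 * ((1 + `|x|) ^+ (2 * d) * (1 + `|x|) ^+ 2 * `|g x|) =
  (1 + `|x|) ^+ (2 * d) * `|g x| * ((d%:R * `|h|) ^+ 2 * (1 + `|x|) ^+ 2) by ring.
rewrite ler_wpM2l ?mulr_ge0 ?exprn_ge0 ?addr_ge0// ler_wpM2l ?sqr_ge0//.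
by rewrite lerXn2r ?nnegrE ?addr_ge0// lerDr.
Qed.

Lemma pd_cos_transform t g j : sch g -> pd j (cos_transform t g) = cos_transform (t + pi / 2) (coord_mul j g).
Proof.
by move=> gS; apply/funext => xi; rewrite /pd (diff_cos_transform t xi gS).2 dot_evec mxE.
Qed.

Lemma is_derive_line g (x e : V) (r : R) : differentiable g (x + r *: e) ->
  is_derive r (1 : R) (fun s : R => g (x + s *: e)) ('D_e g (x + r *: e)).
Proof.
move=> dg; have := diff_derivable (v := e) dg; rewrite /derivable /derive => D.
have E : (fun h : R => h^-1 *: (((fun s : R => g (x + s *: e)) \o shift r) (h *: (1 : R)) -
     (fun s : R => g (x + s *: e)) r)) =
  (fun h : R => h^-1 *: ((g \o shift (x + r *: e)) (h *: e) - g (x + r *: e))).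
  apply/funext => h /=; congr (_ *: (g _ - _)).
  by rewrite scalerDl -scalerA scale1r addrCA.
by split; rewrite /derivable /derive E.
Qed.

(** A function and its translates have the same integral, so the integral of a
    difference quotient vanishes.  The quotient with step [s] differs from the
    derivative by [O(s)] in the mean, because the second derivative decays.
    This stands in for integration by parts. *)
Lemma integralV_pd g j : sch g -> integralV (pd j g) = 0.
Proof.
move=> gS; pose e := evec j : V.
have dg x : differentiable g x := jets_diff x gS.
have g1S := jets_pd j gS; have g2S := jets_pd j g1S.
have dg1 x : differentiable (pd j g) x := jets_diff x g1S.
have [K HK] := jets_val g2S (2 * d)%N.
have e1 : `|e| <= 1.
  apply: norm_le_coord => // i; rewrite mxE; by case: (_ && _); rewrite ?normr1 ?normr0.
(* The step is at most 1, so that a translate changes the weight by a factor 2 at most. *)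
have bound s : 0 < s -> s <= 1 -> `|integralV (pd j g)| <= s * (2 ^+ (2 * d) * K * pi ^+ d).
  move=> s0 s1.
  have i1 := sch_integrableV (sch_shift (s *: e) gS); have i2 := sch_integrableV gS.
  have i3 : integrableV (fun x => s * pd j g x) by exact/integrableVZ/sch_integrableV.
  have i12 : integrableV (fun x => g (x + s *: e) - g x).
    have -> : (fun x => g (x + s *: e) - g x) = (fun x => g (x + s *: e) + -1 * g x).
      by apply/funext => x; rewrite mulN1r.
    by apply: integrableVD => //; exact: integrableVZ.
  have E : integralV (fun x => g (x + s *: e) - g x - s * pd j g x) = - (s * integralV (pd j g)).
    by rewrite integralVB// integralVB// integralV_shift// subrr sub0r integralVZ//; exact: sch_integrableV.
  have : `|integralV (fun x => g (x + s *: e) - g x - s * pd j g x)| <=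
      s ^+ 2 * (2 ^+ (2 * d) * K) * pi ^+ d.
    apply: integralV_bound => [|x].
      apply: measurable_funB; first by case/integrableP : i12 => /measurable_EFinP.
      by case/integrableP : i3 => /measurable_EFinP.
    have [c cs] := mean_value (f := fun r => g (x + r *: e)) (0 : R) s
      (fun r : R => is_derive_line (dg (x + r *: e))).
    rewrite scale0r addr0 !subr0 in cs * => E0.
    have [c' cc] := mean_value (f := fun r => pd j g (x + r *: e)) 0 c
      (fun r => is_derive_line (dg1 (x + r *: e))).
    rewrite scale0r addr0 !subr0 in cc * => E1.
    have -> : g (x + s *: e) - g x - s * pd j g x = s * (pd j (pd j g) (x + c' *: e) * c).
      by rewrite -[pd j (pd j g) _ * c]E1 mulrBr E0 mulrC.
    rewrite !normrM; rewrite (ger0_norm (ltW s0)) in cs *.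
    have w : 1 + `|x| <= 2 * (1 + `|x + c' *: e|).
      have : `|x| <= `|x + c' *: e| + `|c' *: e|.
        by rewrite -[X in `|X| <= _](addrK (c' *: e)) ler_normB.
      have : `|c' *: e| <= 1.
        by rewrite normrZ mulr_ile1// (le_trans (le_trans cc cs)).
      have := normr_ge0 (x + c' *: e); lra.
    have w2 : (1 + `|x|) ^+ (2 * d) <= 2 ^+ (2 * d) * (1 + `|x + c' *: e|) ^+ (2 * d).
      by rewrite -exprMn lerXn2r ?nnegrE ?mulr_ge0 ?addr_ge0.
    have K1 := HK (x + c' *: e).
    set D := `|pd j (pd j g) _| in K1 *.
    have D0 : 0 <= D by exact: normr_ge0.
    have -> : (1 + `|x|) ^+ (2 * d) * (s * (D * `|c|)) =
      (s * `|c|) * ((1 + `|x|) ^+ (2 * d) * D) by ring.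
    apply: ler_pM; rewrite ?mulr_ge0 ?exprn_ge0 ?addr_ge0 ?(ltW s0)//.
      by rewrite expr2 ler_wpM2l// ltW.
    apply: le_trans (ler_wpM2r D0 w2) _.
    by rewrite -mulrA ler_wpM2l ?exprn_ge0.
  rewrite E normrN normrM (ger0_norm (ltW s0)) expr2 -!mulrA ler_pM2l// !mulrA//.
apply/eqP; rewrite -normr_le0; apply/ler_addgt0Pl => eps eps0; rewrite addr0.
set C := 2 ^+ (2 * d) * K * pi ^+ d in bound.
have := bound 1 ltr01 (lexx 1); rewrite mul1r => C0.
have {}C0 : 0 <= C by apply: le_trans C0.
have s0 : 0 < Num.min 1 (eps / (C + 1)).
  by rewrite lt_min ltr01 divr_gt0// ltr_wpDl.
apply: le_trans (bound _ s0 _) _; first by rewrite ge_min lexx.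
apply: (@le_trans _ _ (eps / (C + 1) * C)).
  by rewrite ler_wpM2r// ge_min lexx orbT.
rewrite mulrAC ler_pdivrMr ?ltr_wpDl// ler_wpM2l ?ltW//; lra.
Qed.

(** The integral of the derivative of [g] times a wave is zero; the product
    rule moves the derivative from the wave to [g]. *)
Lemma coord_cos_transform t g (j : 'I_d) (xi : V) : sch g ->
  xi j 0 * cos_transform t g xi = cos_transform (t - pi / 2) (fun x => -1 * pd j g x) xi.
Proof.
move=> gS; have := integralV_pd j (sch_wave (t - pi / 2) xi gS).
rewrite pdM; last 2 first.
- by move=> x; exact: jets_diff gS.
- by move=> x; exact: (diff_wave _ _ _).1.
rewrite pd_wave subrK.
have -> : (fun x => pd j g x * wave xi (t - pi / 2) x + g x * (xi j 0 * wave xi t x)) =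
  (fun x => pd j g x * wave xi (t - pi / 2) x + xi j 0 * (g x * wave xi t x)).
  by apply/funext => x; ring.
have i1 := sch_integrableV (sch_wave t xi gS).
have i2 := sch_integrableV (sch_wave (t - pi / 2) xi (jets_pd j gS)).
rewrite integralVD//; last exact: integrableVZ.
rewrite integralVZ// => /eqP; rewrite addrC addr_eq0 => /eqP ->.
rewrite /cos_transform; under [in RHS]eq_fun do rewrite -mulrA.
by rewrite integralVZ// mulN1r.
Qed.

Lemma cos_transform_bounded t g : sch g -> exists K, forall xi, `|cos_transform t g xi| <= K.
Proof.
move=> gS; have [K HK] := jets_val gS (2 * d)%N; exists (K * pi ^+ d) => xi.
apply: integralV_bound => [|x]; first by apply: sch_measurable; exact: sch_wave.
apply: le_trans (HK x); rewrite ler_wpM2l ?exprn_ge0 ?addr_ge0// normrM.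
by rewrite ler_piMr// ler_norml cos_geN1 cos_le1.
Qed.

(** Each factor [1 + |xi|] is bounded by one plus the sum of the [|xi_j|], and
    a factor [xi_j] turns the transform of [g] into the transform of a
    derivative of [g]. *)
Lemma cos_transform_decays t g : sch g -> decays (cos_transform t g).
Proof.
move=> gS N; elim: N t g gS => [|N IH] t g gS.
  by have [K HK] := cos_transform_bounded t gS; exists K => xi; rewrite expr0 mul1r.
have [K HK] := IH t g gS.
have P j : exists Kj, forall xi : V, (1 + `|xi|) ^+ N * `|xi j 0 * cos_transform t g xi| <= Kj.
  have [Kj HKj] := IH (t - pi / 2) _ (schZ (-1) (jets_pd j gS)); exists Kj => xi.
  by rewrite coord_cos_transform.
have [Kf HKf] := choice P.
exists (K + \sum_j Kf j) => xi; rewrite exprSr -mulrA mulrDl mul1r mulrDr.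
apply: lerD => //; apply: le_trans (_ : \sum_j (1 + `|xi|) ^+ N * `|xi j 0 * cos_transform t g xi| <= _).
  rewrite -mulr_sumr ler_wpM2l ?exprn_ge0 ?addr_ge0//.
  under eq_bigr do rewrite normrM.
  by rewrite -mulr_suml ler_wpM2r//; exact: norm_le_l1norm.
exact: ler_sum.
Qed.

(** The transforms of Schwartz functions, with all phases, form a class of
    rapidly decreasing functions that is closed under partial derivatives. *)
Lemma sch_cos_transform t g : sch g -> sch (cos_transform t g).
Proof.
move=> gS; apply: (@jets_coind _ _ decays
  [set h | exists p : R * (V -> R), sch p.2 /\ h = cos_transform p.1 p.2]); last by exists (t, g).
- move=> _ [[s f] /= [fS ->]]; split; last exact: cos_transform_decays.
  by move=> x; exact: (diff_cos_transform _ _ fS).1.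
- move=> _ j [[s f] /= [fS ->]]; exists (s + pi / 2, coord_mul j f); split => /=.
    exact: sch_coord_mul.
  exact: pd_cos_transform.
Qed.

Lemma fourierE (f : V -> R[i]) : schwartz f ->
  Re_fun (fourier f) = (fun xi => cos_transform 0 (Re_fun f) xi + cos_transform (- (pi / 2)) (Im_fun f) xi) /\
  Im_fun (fourier f) = (fun xi => cos_transform 0 (Im_fun f) xi + -1 * cos_transform (- (pi / 2)) (Re_fun f) xi).
Proof.
move=> /schwartzP[fr fi].
have c0 a : cos (a + 0) = cos a :> R by rewrite addr0.
have cs a : cos (a - pi / 2) = sin a :> R by rewrite cosB cos_pihalf sin_pihalf mulr0 mulr1 add0r.
split; apply/funext => xi.
- rewrite /cos_transform -integralVD; [|exact/sch_integrableV/sch_wave|exact/sch_integrableV/sch_wave].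
  rewrite /Re_fun /fourier /cintegral /=; congr (integralV _); apply/funext => x.
  by rewrite /wave c0 cs /Re_fun /Im_fun; case: (f x) => a b /=; rewrite mulrN opprK.
- rewrite /cos_transform -integralVZ -?integralVD; [|exact/sch_integrableV/sch_wave|exact/integrableVZ/sch_integrableV/sch_wave|exact/sch_integrableV/sch_wave].
  rewrite /Im_fun /fourier /cintegral /=; congr (integralV _); apply/funext => x.
  by rewrite /wave c0 cs /Re_fun /Im_fun; case: (f x) => a b /=; ring.
Qed.

Lemma schwartz_fourier (f : V -> R[i]) : schwartz f -> schwartz (fourier f).
Proof.
move=> fS; have [E1 E2] := fourierE fS; have /schwartzP[fr fi] := fS.
apply/schwartzP; rewrite E1 E2; split; apply: schD; try exact: sch_cos_transform.
exact/schZ/sch_cos_transform.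
Qed.

End oscillatory.

(** * Finite-difference operators and their symbols *)

Section symbols.
Context {R : realType} {d : nat}.
Local Notation V := 'cV[R]_d.
Local Notation C := R[i].
Local Notation sch := (jets decays).
Implicit Types (psi : V -> C) (u v : @dist R d) (T : V -> C)
  (Op : @dist R d -> @dist R d).

Lemma Re_lin (a z w : C) : complex.Re (a * z + w) =
  complex.Re a * complex.Re z + (- complex.Im a * complex.Im z + complex.Re w).
Proof. by case: a z w => [? ?] [? ?] [? ?] /=; ring. Qed.

Lemma Im_lin (a z w : C) : complex.Im (a * z + w) =
  complex.Re a * complex.Im z + (complex.Im a * complex.Re z + complex.Im w).
Proof. by case: a z w => [? ?] [? ?] [? ?] /=; ring. Qed.

Lemma complex_eqP (z w : C) :
  complex.Re z = complex.Re w -> complex.Im z = complex.Im w -> z = w.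
Proof. by case: z w => [? ?] [? ?] /= -> ->. Qed.

Lemma cmod_lin (a z w : C) : cmod (a * z + w) <= cmod a * cmod z + cmod w.
Proof.
have cD (x y : C) : cmod (x + y) <= cmod x + cmod y.
  have := ler_normD x y; rewrite lecE => /andP[_].
  by rewrite /cmod raddfD.
apply: le_trans (cD _ _) _; rewrite lerD2r.
by rewrite /cmod normrM; case: a z => [? ?] [? ?] /=; rewrite mulr0 subr0.
Qed.

Lemma schwartz_lin (a : C) (f g : V -> C) : schwartz f -> schwartz g ->
  schwartz (fun x => a * f x + g x).
Proof.
move=> /schwartzP[fr fi] /schwartzP[gr gi]; apply/schwartzP; split.
- have -> : Re_fun (fun x => a * f x + g x) = fun x =>
      complex.Re a * Re_fun f x + (- complex.Im a * Im_fun f x + Re_fun g x).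
    by apply/funext => x; exact: Re_lin.
  by do 2 (apply: schD; first exact: schZ).
- have -> : Im_fun (fun x => a * f x + g x) = fun x =>
      complex.Re a * Im_fun f x + (complex.Im a * Re_fun f x + Im_fun g x).
    by apply/funext => x; exact: Im_lin.
  by do 2 (apply: schD; first exact: schZ).
Qed.

Lemma schwartz0 : schwartz (fun _ : V => 0 : C).
Proof.
have z : sch (fun _ : V => 0 : R).
  apply: (@jets_coind _ _ decays [set h | h = cst 0]) => //.
  - move=> _ ->; split; first by move=> x; exact: differentiable_cst.
    by move=> N; exists 0 => x; rewrite normr0 mulr0.
  - by move=> _ j ->; apply/funext => x; exact: derive_cst.
by apply/schwartzP.
Qed.

Lemma schwartz_shift psi (a : V) : schwartz psi -> schwartz (fun x => psi (x + a)).
Proof.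
by move=> /schwartzP[fr fi]; apply/schwartzP; split;
  [exact: (sch_shift a fr)|exact: (sch_shift a fi)].
Qed.

Lemma cos_transform_lin t (c : R) (f g : V -> R) xi : sch f -> sch g ->
  cos_transform t (fun x => c * f x + g x) xi = c * cos_transform t f xi + cos_transform t g xi.
Proof.
move=> fS gS; have fi := sch_integrableV (sch_wave t xi fS); have gi := sch_integrableV (sch_wave t xi gS).
rewrite /cos_transform -integralVZ// -integralVD//; last exact: integrableVZ.
by congr integralV; apply/funext => x; ring.
Qed.

Lemma fourier_lin (a : C) (f g : V -> C) : schwartz f -> schwartz g ->
  fourier (fun x => a * f x + g x) = fun xi => a * fourier f xi + fourier g xi.
Proof.
move=> fS gS; have [E1 E2] := fourierE (schwartz_lin a fS gS).
have [F1 F2] := fourierE fS; have [G1 G2] := fourierE gS.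
have /schwartzP[fr fi] := fS; have /schwartzP[gr gi] := gS.
have EE (h1 h2 : V -> R) xi : h1 = h2 -> h1 xi = h2 xi by move=> ->.
have rE : Re_fun (fun x => a * f x + g x) = fun x =>
    complex.Re a * Re_fun f x + (- complex.Im a * Im_fun f x + Re_fun g x).
  by apply/funext => x; exact: Re_lin.
have iE : Im_fun (fun x => a * f x + g x) = fun x =>
    complex.Re a * Im_fun f x + (complex.Im a * Re_fun f x + Im_fun g x).
  by apply/funext => x; exact: Im_lin.
rewrite rE iE in E1 E2.
have s1 : sch (fun x => - complex.Im a * Im_fun f x + Re_fun g x).
  by apply: schD => //; exact: schZ.
have s2 : sch (fun x => complex.Im a * Re_fun f x + Im_fun g x).
  by apply: schD => //; exact: schZ.
apply/funext => xi; apply: complex_eqP.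
- rewrite Re_lin.
  rewrite -[LHS]/(Re_fun (fourier (fun x => a * f x + g x)) xi).
  rewrite -[complex.Re (fourier f xi)]/(Re_fun (fourier f) xi).
  rewrite -[complex.Im (fourier f xi)]/(Im_fun (fourier f) xi).
  rewrite -[complex.Re (fourier g xi)]/(Re_fun (fourier g) xi).
  rewrite E1 F1 F2 G1 !cos_transform_lin//; ring.
- rewrite Im_lin.
  rewrite -[LHS]/(Im_fun (fourier (fun x => a * f x + g x)) xi).
  rewrite -[complex.Re (fourier f xi)]/(Re_fun (fourier f) xi).
  rewrite -[complex.Im (fourier f xi)]/(Im_fun (fourier f) xi).
  rewrite -[complex.Im (fourier g xi)]/(Im_fun (fourier g) xi).
  rewrite E2 F1 F2 G2 !cos_transform_lin//; ring.
Qed.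

(** [Op] acts on Fourier transforms as multiplication by [T].  The rule is
    stated for all tempered distributions together with the preservation of
    temperedness, so that it passes to sums and can be iterated. *)
Definition has_symbol Op T :=
  (forall psi, schwartz psi -> schwartz (fun x => T x * psi x)) /\
  forall u, tempered u -> tempered (Op u) /\
    forall psi, schwartz psi -> Op u (fourier psi) = u (fourier (fun x => T x * psi x)).

Lemma tempered_lin (a : C) u v : tempered u -> tempered v ->
  tempered (fun psi => a * u psi + v psi).
Proof.
move=> [ul [K1 [N1 H1]]] [vl [K2 [N2 H2]]]; split.
  by move=> b f g fS gS; rewrite ul// vl//; ring.
exists (cmod a * K1 + K2), (maxn N1 N2) => psi B psiS HB.
have le N : (N <= maxn N1 N2)%N -> forall l, (size l <= N)%N -> forall x : V,
    (1 + `|x|) ^+ N * cmod (cpderiv l psi x) <= B.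
  move=> NN l lN x; apply: le_trans (HB l (leq_trans lN NN) x).
  by rewrite ler_wpM2r ?ler_weXn2l ?lerDl// (le_trans _ (Re_cmod _)).
apply: le_trans (cmod_lin _ _ _) _; rewrite mulrDl; apply: lerD.
  rewrite -mulrA ler_wpM2l ?(le_trans _ (Re_cmod _))//.
  by apply: H1 => //; apply: le; exact: leq_maxl.
by apply: H2 => //; apply: le; exact: leq_maxr.
Qed.

Lemma tempered0 : tempered (fun _ : V -> C => 0).
Proof.
split; first by move=> *; rewrite mulr0 addr0.
by exists 0, 0%N => psi B _ _; rewrite mul0r cmodE /= expr0n addr0 sqrtr0.
Qed.

Lemma pderiv_shift l (g : V -> R) (a : V) :
  pderiv l (fun x => g (x + a)) = fun x => pderiv l g (x + a).
Proof. by elim: l => //= j l ->; exact: pd_shift. Qed.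

Lemma tempered_translate (a : V) u : tempered u -> tempered (translate a u).
Proof.
move=> [ul [K [N H]]]; split.
  by move=> b f g fS gS; rewrite /translate ul//; exact: schwartz_shift.
exists (K * (1 + `|a|) ^+ N), N => psi B psiS HB; rewrite /translate -mulrA.
apply: H; first exact: schwartz_shift.
move=> l lN x.
have -> : cpderiv l (fun x => psi (x + a)) x = cpderiv l psi (x + a).
  rewrite /cpderiv; congr Complex.
    by rewrite -[RHS]/((fun x => pderiv l (Re_fun psi) (x + a)) x) -pderiv_shift.
  by rewrite -[RHS]/((fun x => pderiv l (Im_fun psi) (x + a)) x) -pderiv_shift.
apply: le_trans (ler_wpM2l _ (HB l lN (x + a))); last by rewrite exprn_ge0 ?addr_ge0.
rewrite mulrA ler_wpM2r ?(le_trans _ (Re_cmod _))//.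
rewrite -exprMn lerXn2r ?nnegrE ?mulr_ge0 ?addr_ge0//.
have : `|x| <= `|x + a| + `|a| by rewrite -[X in `|X| <= _](addrK a) ler_normB.
have := normr_ge0 (x + a); have := normr_ge0 a; nra.
Qed.

(** The character by which the Fourier transform turns translation by [a] into
    multiplication. *)
Definition character (a : V) : V -> C := fun x => Complex (cos (dot a x)) (- sin (dot a x)).

Lemma schwartz_character (a : V) psi : schwartz psi -> schwartz (fun x => character a x * psi x).
Proof.
have c0 b : cos (b + 0) = cos b :> R by rewrite addr0.
have cs b : cos (b - pi / 2) = sin b :> R by rewrite cosB cos_pihalf sin_pihalf mulr0 mulr1 add0r.
move=> /schwartzP[fr fi]; apply/schwartzP; split.
- have -> : Re_fun (fun x => character a x * psi x) = fun x =>
      Re_fun psi x * wave a 0 x + Im_fun psi x * wave a (- (pi / 2)) x.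
    apply/funext => x; rewrite /Re_fun /Im_fun /wave c0 cs /character.
    by case: (psi x) => ? ? /=; ring.
  by apply: schD; exact: sch_wave.
- have -> : Im_fun (fun x => character a x * psi x) = fun x =>
      Im_fun psi x * wave a 0 x + -1 * (Re_fun psi x * wave a (- (pi / 2)) x).
    apply/funext => x; rewrite /Re_fun /Im_fun /wave c0 cs /character.
    by case: (psi x) => ? ? /=; ring.
  by apply: schD; [exact: sch_wave|apply: schZ; exact: sch_wave].
Qed.

Lemma has_symbol_translate (a : V) : has_symbol (translate a) (character a).
Proof.
split; first exact: schwartz_character.
move=> u ut; split; first exact: tempered_translate.
move=> psi psiS; rewrite /translate; congr u; apply/funext => xi.
rewrite /fourier; congr cintegral; apply/funext => x.
rewrite dotDl cosD sinD /character; case: (psi x) => p q.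
by apply: complex_eqP => /=; ring.
Qed.

Lemma has_symbol_lin (c : C) Op1 Op2 T1 T2 : has_symbol Op1 T1 -> has_symbol Op2 T2 ->
  has_symbol (fun u psi => c * Op1 u psi + Op2 u psi) (fun x => c * T1 x + T2 x).
Proof.
have E (psi : V -> C) : (fun x => (c * T1 x + T2 x) * psi x) =
    (fun x => c * (T1 x * psi x) + T2 x * psi x).
  by apply/funext => x; ring.
move=> [S1 H1] [S2 H2]; split.
  by move=> psi psiS; rewrite E; apply: schwartz_lin; [exact: S1|exact: S2].
move=> u ut; have [t1 F1] := H1 u ut; have [t2 F2] := H2 u ut.
split; first exact: tempered_lin.
move=> psi psiS; rewrite E fourier_lin; [|exact: S1|exact: S2].
have [ul _] := ut; rewrite F1// F2// ul//; apply: schwartz_fourier; [exact: S1|exact: S2].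
Qed.

Lemma has_symbol0 : has_symbol (fun _ _ => 0) (fun _ => 0).
Proof.
have E (psi : V -> C) : (fun x => 0 * psi x) = (fun _ => 0 : C).
  by apply/funext => x; rewrite mul0r.
split; first by move=> psi _; rewrite E; exact: schwartz0.
move=> u [ul uc]; split; first exact: tempered0.
move=> psi _; rewrite E; have zS := schwartz0.
have fz := schwartz_fourier zS.
have F0 : fourier (fun _ : V => 0 : C) = fun _ => 0.
  have := fourier_lin (-1) zS zS.
  have -> : (fun x : V => -1 * 0 + 0) = (fun _ => 0 : C) by apply/funext => x; rewrite mulr0 addr0.
  by move=> ->; apply/funext => x; rewrite mulN1r addNr.
rewrite F0; have := ul (-1) _ _ zS zS.
have -> : (fun x : V => -1 * 0 + 0) = (fun _ => 0 : C) by apply/funext => x; rewrite mulr0 addr0.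
by rewrite mulN1r addNr.
Qed.

Lemma has_symbolZ (c : C) Op T : has_symbol Op T ->
  has_symbol (fun u psi => c * Op u psi) (fun x => c * T x).
Proof.
move=> H; have := has_symbol_lin c H has_symbol0.
under eq_fun do under eq_fun do rewrite addr0.
by under [X in has_symbol _ X]eq_fun do rewrite addr0.
Qed.

Lemma has_symbolD Op1 Op2 T1 T2 : has_symbol Op1 T1 -> has_symbol Op2 T2 ->
  has_symbol (fun u psi => Op1 u psi + Op2 u psi) (fun x => T1 x + T2 x).
Proof.
move=> H1 H2; have := has_symbol_lin 1 H1 H2.
under eq_fun do under eq_fun do rewrite mul1r.
by under [X in has_symbol _ X]eq_fun do rewrite mul1r.
Qed.

Lemma has_symbol_sum (I : Type) (s : seq I) (P : pred I)
    (Op : I -> @dist R d -> @dist R d) (T : I -> V -> C) :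
  (forall i, has_symbol (Op i) (T i)) ->
  has_symbol (fun u psi => \sum_(i <- s | P i) Op i u psi) (fun x => \sum_(i <- s | P i) T i x).
Proof.
move=> H; elim: s => [|i s IH].
  under eq_fun do under eq_fun do rewrite big_nil.
  by under [X in has_symbol _ X]eq_fun do rewrite big_nil; exact: has_symbol0.
under eq_fun do under eq_fun do rewrite big_cons.
under [X in has_symbol _ X]eq_fun do rewrite big_cons.
by case: (P i) => //; exact: has_symbolD.
Qed.

Lemma has_symbol_eq Op T Op' T' : has_symbol Op T ->
  (forall u psi, Op' u psi = Op u psi) -> (forall x, T' x = T x) -> has_symbol Op' T'.
Proof.
move=> H E1 E2; suff [-> ->] : Op' = Op /\ T' = T by [].
by split; [apply/funext => u; apply/funext => psi|apply/funext].
Qed.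

(** The characters of [e_i] and [- e_i] add up to [2 cos x_i], and [2 cos x_i -
    2 = - 4 sin (x_i / 2) ^ 2]. *)
Lemma has_symbol_D2 i : has_symbol (D2 i)
  (fun x => real_complex R (- (4 * sin (x i 0 / 2) ^+ 2))).
Proof.
apply: (has_symbol_eq (has_symbolD (has_symbolD (has_symbol_translate (evec i))
   (has_symbolZ (-2) (has_symbol_translate 0))) (has_symbol_translate (- evec i)))).
  move=> u psi; rewrite /D2 mulNr; congr (_ - 2 * _ + _); rewrite /translate.
  by congr u; apply/funext => x; rewrite addr0.
move=> x; rewrite /character dotNl (dotC (evec i)) dot_evec (dotC 0) -(scale0r 0) dotZr mul0r.
rewrite cosN sinN cos0 sin0; set t := x i 0.
have -> : cos t = 1 - 2 * sin (t / 2) ^+ 2.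
  by have := cos2Dsin2 (t / 2); rewrite [in cos t](splitr t) cosD -!expr2; lra.
apply: complex_eqP => /=; ring.
Qed.

(** The difference of the cosines of [x_i + x_j] and [x_i - x_j] is [- 2 sin
    x_i sin x_j]. *)
Lemma has_symbol_D11 i j : has_symbol (D11 i j)
  (fun x => real_complex R (- (sin (x i 0) * sin (x j 0)))).
Proof.
apply: (has_symbol_eq (has_symbolZ (4^-1) (has_symbolD (has_symbolD (has_symbolD
   (has_symbol_translate (evec i + evec j))
   (has_symbol_translate (- evec i - evec j)))
   (has_symbolZ (-1) (has_symbol_translate (evec i - evec j))))
   (has_symbolZ (-1) (has_symbol_translate (evec j - evec i)))))).
  by move=> u psi; rewrite /D11 !mulN1r.
move=> x; rewrite /character !dotDl !dotNl !(dotC _ x) !dot_evec.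
rewrite !cosD !sinD !sinN !cosN; apply: (@mulfI _ 4); first by rewrite pnatr_eq0.
rewrite mulrA mulfV ?pnatr_eq0// mul1r.
apply: complex_eqP => /=; ring.
Qed.

Lemma has_symbol_calG (Q : 'M[R]_d) : has_symbol (calG Q) (G_symbol Q).
Proof.
apply: (has_symbol_eq (has_symbolD
  (has_symbolZ (-1) (has_symbol_sum (index_enum 'I_d) xpredT
     (fun i => has_symbolZ (real_complex R (Q2 Q i i)) (has_symbol_D2 i))))
  (has_symbolZ (-2) (has_symbol_sum (index_enum 'I_d) xpredT
     (fun i => has_symbol_sum (index_enum 'I_d) (fun j => (i < j)%N)
     (fun j => has_symbolZ (real_complex R (Q2 Q i j)) (has_symbol_D11 i j))))))).
  by move=> u psi; rewrite /calG mulN1r mulNr.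
move=> x; rewrite /G_symbol /trigG rmorphD !rmorphM !rmorph_sum !mulr_sumr.
congr (_ + _); apply: eq_bigr => i _.
  by rewrite -!rmorphM /=; apply: complex_eqP => /=; ring.
rewrite !rmorph_sum !mulr_sumr; apply: eq_bigr => j _.
by rewrite -!rmorphM /=; apply: complex_eqP => /=; ring.
Qed.

Lemma symbol_op_calG (Q : 'M[R]_d) u : tempered u -> symbol_op (G_symbol Q) u (calG Q u).
Proof.
move=> ut; have [S H] := has_symbol_calG Q; have [ct E] := H u ut.
by split => //; apply: dist_prod_multiplier.
Qed.

End symbols.

(** * Infinite products *)

Section infinite_product.
Context {R : realType}.

(** The bound is uniform in the number of factors: [1 + y <= exp y] reduces it
    to a geometric series. *)
Lemma infinite_prod_bound (u : nat -> R) (c r : R) n : 0 <= c -> 0 <= r < 1 ->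
  (forall j, `|u j - 1| <= c * r ^+ j) ->
  `|\prod_(0 <= j < n) u j| <= expR (c / (1 - r)).
Proof.
move=> c0 /andP[r0 r1] H.
have r10 : 0 < 1 - r by rewrite subr_gt0.
apply: (@le_trans _ _ (expR (\sum_(0 <= j < n) c * r ^+ j))).
  rewrite expR_sum normr_prod; apply: ler_prod => j _; rewrite normr_ge0 /=.
  apply: le_trans (expR_ge1Dx _); have := H j; have := ler_normD (u j - 1) 1.
  rewrite subrK normr1; lra.
rewrite ler_expR -mulr_sumr ler_wpM2l// big_mkord.
rewrite -[leRHS]mul1r ler_pdivlMr// mulrC.
have := subrXX (1 : R) r n; rewrite expr1n => E.
have -> : (1 - r) * \sum_(i < n) r ^+ i = 1 - r ^+ n.
  by rewrite E; congr (_ * _); apply: eq_bigr => i _; rewrite expr1n mul1r.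
by rewrite gerBl exprn_ge0.
Qed.

(** The increments of the partial products are dominated by a geometric series,
    since the partial products are bounded. *)
Lemma is_cvg_infinite_prod (u : nat -> R) (c r : R) : 0 <= c -> 0 <= r < 1 ->
  (forall j, `|u j - 1| <= c * r ^+ j) ->
  cvgn (fun n => \prod_(0 <= j < n) u j).
Proof.
move=> c0 r01 H; pose p n := \prod_(0 <= j < n) u j; have /andP[r0 r1] := r01.
have -> : (fun n => \prod_(0 <= j < n) u j) = (fun n => p 0%N + series (telescope p) n).
  by apply/funext => n; rewrite -eq_sum_telescope.
apply: is_cvgD; first exact: is_cvg_cst.
apply: normed_cvg.
apply: (@series_le_cvg _ _ (fun j => expR (c / (1 - r)) * c * r ^+ j)) => [j|j|j|].
- exact: normr_ge0.
- by rewrite !mulr_ge0 ?exprn_ge0 ?expR_ge0.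
- rewrite /=; have -> : telescope p j = p j * (u j - 1).
    by rewrite /telescope /= /p big_nat_recr//= mulrBr mulr1.
  rewrite normrM.
  by rewrite -mulrA ler_pM// infinite_prod_bound.
- by apply: is_cvg_geometric_series; rewrite ger0_norm.
Qed.

End infinite_product.

(** * The dilation contracts the quadratic form *)

Section dilation.
Context {R : realType} {d : nat}.
Local Notation V := 'cV[R]_d.
Variables (A : 'M[int]_d) (Q : 'M[R]_d).
Hypothesis d_gt0 : (0 < d)%N.
Hypothesis hA : @isotropic_dilation R d A.
Hypothesis hQ : elliptic_factor A Q.

(** The determinant is, up to sign, the product of the complex eigenvalues, and
    there is at least one of them. *)
Lemma det_gt1 : 1 < `|\det A|.
Proof.
have [ev _ _] := hA.
set AC := (map_mx intr A : 'M[R[i]]_d) in ev.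
have : 1 < `|\det AC|.
  have [rs E] := closed_field_poly_normal (char_poly AC).
  rewrite (monicP (char_poly_monic AC)) scale1r in E.
  have szrs : size rs = d.
    by have := size_char_poly AC; rewrite E size_prod_XsubC => -[].
  have : `|\det AC| = \prod_(z <- rs) `|z|.
    have := char_poly_det AC; rewrite -horner_coef0 E horner_prod => E2.
    have : `|\prod_(z <- rs) ('X - z%:P).[0]| = `|\det AC|.
      by rewrite E2 normrM normrX normrN1 expr1n mul1r.
    move=> <-; rewrite normr_prod; apply: eq_bigr => z _.
    by rewrite hornerXsubC sub0r normrN.
  move=> ->.
  have big1 z : z \in rs -> 1 < `|z|.
    by move=> zrs; apply: ev; rewrite eigenvalue_root_char E root_prod_XsubC.
  case: rs szrs big1 {E} => [d0|z rs _ H]; first by move: d_gt0; rewrite -d0.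
  have zrs : forall w, w \in rs -> 1 < `|w| by move=> w wrs; apply: H; rewrite inE wrs orbT.
  have ge1 : 1 <= \prod_(w <- rs) `|w|.
    elim: rs {H} zrs => [|w rs IH] H; first by rewrite big_nil.
    rewrite big_cons mulr_ege1 ?IH//; first by rewrite ltW// H ?mem_head.
    by move=> v vrs; apply: H; rewrite inE vrs orbT.
  have z1 : 1 < `|z| by apply: H; rewrite mem_head.
  by rewrite big_cons; apply: lt_le_trans z1 _; rewrite ler_peMr.
have -> : \det AC = (\det A)%:~R by rewrite -det_map_mx.
by rewrite -intr_norm -[1 in X in X -> _]/(1%:~R) ltr_int.
Qed.

Lemma detR : \det (realA A : 'M[R]_d) = (\det A)%:~R.
Proof. by rewrite -det_map_mx. Qed.

Lemma qdet_gt1 : 1 < qdet A :> R.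
Proof. by rewrite /qdet detR -intr_norm -[1 in X in X < _]/(1%:~R) ltr_int det_gt1. Qed.

Lemma realAT_unit : (realA A : 'M[R]_d)^T \in unitmx.
Proof.
rewrite unitmx_tr unitmxE unitfE detR intr_eq0.
by rewrite -normr_gt0 (lt_trans _ det_gt1).
Qed.

Local Notation B := (AmT A : 'M[R]_d).
(** The common modulus of the eigenvalues of [AmT A]. *)
Definition rho : R := powR (qdet A) (- d%:R^-1).

Lemma rho_gt0 : 0 < rho.
Proof. by rewrite powR_gt0// (lt_trans _ qdet_gt1). Qed.

Lemma rho_lt1 : rho < 1.
Proof.
rewrite /rho powRN invf_lt1 ?powR_gt0 ?(lt_trans ltr01 qdet_gt1)//.
have {1}-> : (1 : R) = powR 1 d%:R^-1 by rewrite powR1.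
by rewrite gt0_ltr_powR ?nnegrE ?(ltW (lt_trans ltr01 qdet_gt1)) ?invr_gt0 ?ltr0n ?qdet_gt1.
Qed.

Lemma rho_sqr : powR (qdet A) (2 / d%:R) * rho ^+ 2 = 1.
Proof.
have q0 : qdet A != 0 :> R by rewrite gt_eqF// (lt_trans ltr01 qdet_gt1).
rewrite expr2 mulrA /rho -!powRD ?q0 ?implybT//.
by have -> : 2 / d%:R + - d%:R^-1 + - d%:R^-1 = 0 :> R; [ring|rewrite powRr0].
Qed.

Lemma mul_realAT_AmT (x : V) : (realA A)^T *m (B *m x) = x.
Proof. by rewrite mulmxA mulmxV ?mul1mx// realAT_unit. Qed.

Lemma Q_unit : Q \in unitmx.
Proof.
have [QT Qpos _] := hQ.
rewrite -row_free_unit -kermx_eq0; apply/negPn/negP => /rowV0Pn[v /sub_kermxP vQ v0].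
have := Qpos v^T; rewrite trmxK vQ mul0mx mxE ltxx => H.
by have /H : v^T != 0 by apply: contra v0 => /eqP vT0; rewrite -[v]trmxK vT0 trmx0.
Qed.

Lemma formPE (x : V) : formP Q x = \sum_i ((Q *m x) i 0) ^+ 2.
Proof.
have [QT _ _] := hQ.
rewrite /formP /Q2 mulmxA -mulmxA -{1}QT -trmx_mul mxE.
by apply: eq_bigr => i _; rewrite mxE expr2.
Qed.

Lemma formP_ge0 (x : V) : 0 <= formP Q x.
Proof. by rewrite formPE sumr_ge0// => i _; exact: sqr_ge0. Qed.

Lemma formP_eq0 (x : V) : formP Q x = 0 -> x = 0.
Proof.
rewrite formPE => /eqP; rewrite psumr_eq0; last by move=> i _; exact: sqr_ge0.
move=> /allP H; suff Qx : Q *m x = 0 by rewrite -(mul1mx x) -(mulVmx Q_unit) -mulmxA Qx mulmx0.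
apply/colP => i; rewrite [RHS]mxE; apply/eqP; rewrite -sqrf_eq0.
by apply: H; rewrite mem_index_enum.
Qed.

Lemma formP0 : formP Q 0 = 0.
Proof. by rewrite formPE big1// => i _; rewrite mulmx0 mxE expr0n. Qed.

(** [Q] conjugates [AmT A] to [rho] times an orthogonal matrix, and [formP Q]
    is the square of the Euclidean norm of [Q *m x]. *)
Lemma formP_AmT (x : V) : formP Q (B *m x) = rho ^+ 2 * formP Q x.
Proof.
have [_ _ [U UU BE]] := hQ.
have E : Q *m (B *m x) = rho *: (U *m (Q *m x)).
  rewrite BE -scalemxAl -scalemxAr; congr (_ *: _).
  by rewrite -!mulmxA (mulmxA Q (invmx Q)) mulmxV ?mul1mx ?Q_unit.
have sq (y : V) : \sum_i (y i 0) ^+ 2 = (y^T *m y) 0 0.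
  by rewrite mxE; apply: eq_bigr => i _; rewrite mxE expr2.
rewrite !formPE E; under eq_bigr do rewrite mxE exprMn.
rewrite -mulr_sumr; congr (_ * _).
by rewrite !sq trmx_mul mulmxA -(mulmxA _ U^T U) UU mulmx1.
Qed.

(** Together with [formP_upper], this makes [formP Q] equivalent to the square
    of the norm, which transfers the exact scaling of [formP Q] to the norm. *)
Lemma formP_lower : exists2 c : R, 0 <= c & forall x : V, `|x| ^+ 2 <= c * formP Q x.
Proof.
pose a := \sum_i \sum_j `|invmx Q i j|.
have a0 : 0 <= a by do 2 apply: sumr_ge0 => ? _.
exists (a ^+ 2) => [|x]; first exact: sqr_ge0.
have P0 := formP_ge0 x.
rewrite -[formP Q x]sqr_sqrtr// -exprMn lerXn2r ?nnegrE ?mulr_ge0 ?sqrtr_ge0//.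
apply: norm_le_coord => [|i]; first by rewrite mulr_ge0 ?sqrtr_ge0.
have -> : x i 0 = \sum_j invmx Q i j * (Q *m x) j 0.
  by rewrite -[x in LHS]mul1mx -(mulVmx Q_unit) -mulmxA mxE.
apply: le_trans (ler_norm_sum _ _ _) _.
rewrite /a [leRHS]mulr_suml [leRHS](bigD1 i)//= ler_wpDr//.
  by apply: sumr_ge0 => k _; rewrite mulr_ge0 ?sqrtr_ge0 ?sumr_ge0.
rewrite mulr_suml; apply: ler_sum => j _; rewrite normrM ler_wpM2l//.
rewrite -sqrtr_sqr ler_wsqrtr// formPE (bigD1 j)//= lerDl.
by apply: sumr_ge0 => k _; exact: sqr_ge0.
Qed.

Lemma formP_sum (x : V) : formP Q x = \sum_i \sum_j Q2 Q i j * (x i 0 * x j 0).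
Proof.
rewrite /formP -mulmxA mxE; apply: eq_bigr => i _.
by rewrite !mxE mulr_sumr; apply: eq_bigr => j _; ring.
Qed.

Lemma formP_upper : exists2 c : R, 0 <= c & forall x : V, formP Q x <= c * `|x| ^+ 2.
Proof.
exists (\sum_i \sum_j `|Q2 Q i j|) => [|x]; first by do 2 apply: sumr_ge0 => ? _.
rewrite formP_sum mulr_suml; apply: ler_sum => i _; rewrite mulr_suml; apply: ler_sum => j _.
apply: le_trans (ler_norm _) _; rewrite !normrM ler_wpM2l// expr2.
by apply: ler_pM => //; exact: coord_norm.
Qed.

Local Notation Bn n x := (iter n (mulmx B) x).

Lemma formP_iter n (x : V) : formP Q (Bn n x) = (rho ^+ n) ^+ 2 * formP Q x.
Proof.
elim: n => [|n IH]; first by rewrite expr0 expr1n mul1r.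
by rewrite iterS formP_AmT IH (exprS _ n) exprMn mulrA.
Qed.

Lemma iter_AmT_norm : exists2 K : R, 1 <= K & forall n (x : V), `|Bn n x| <= K * rho ^+ n * `|x|.
Proof.
have [c c0 Hc] := formP_lower; have [C C0 HC] := formP_upper.
have r0 := rho_gt0.
exists (c * C + 1) => [|n x]; first by rewrite lerDr mulr_ge0.
have K0 : 0 <= (c * C + 1) * rho ^+ n * `|x|.
  by rewrite !mulr_ge0 ?addr_ge0 ?exprn_ge0 ?mulr_ge0// ltW.
rewrite -(@ler_pXn2r _ 2) ?nnegrE//.
apply: le_trans (Hc _) _; rewrite formP_iter mulrCA.
rewrite [leRHS](_ : _ = (rho ^+ n) ^+ 2 * ((c * C + 1) ^+ 2 * `|x| ^+ 2)); last by ring.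
rewrite ler_wpM2l ?sqr_ge0//.
apply: le_trans (ler_wpM2l c0 (HC x)) _; rewrite mulrA ler_wpM2r ?sqr_ge0//.
have : 0 <= c * C by rewrite mulr_ge0.
nra.
Qed.

Lemma iter_AmTB n (x y : V) : Bn n x - Bn n y = Bn n (x - y).
Proof. by elim: n => //= n IH; rewrite -mulmxBr IH. Qed.

(** Membership in the lattice [2 pi Z^d], in the form used by [mu]. *)
Definition lattice2pi (x : V) := forall i, x i 0 / (2 * pi) \is a Num.int.

Lemma lattice2pi_AT (x : V) : lattice2pi x -> lattice2pi ((realA A)^T *m x).
Proof.
move=> lx i; rewrite mxE mulr_suml; apply: rpred_sum => j _.
rewrite -mulrA rpredM//; by rewrite !mxE intr_int.
Qed.

Lemma lattice2pi_AmT (x : V) : lattice2pi (B *m x) -> lattice2pi x.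
Proof. by move=> /lattice2pi_AT; rewrite mul_realAT_AmT. Qed.

End dilation.

(** * Bounded Lipschitz functions *)

Section bounded_lipschitz.
Context {R : realType} {d : nat}.
Local Notation V := 'cV[R]_d.

(** One constant serves both bounds, which makes stability under products
    immediate. *)
Definition bounded_lipschitz (f : V -> R) := exists K, forall x y, `|f x| <= K /\ `|f x - f y| <= K * `|x - y|.

Lemma bounded_lipschitz_ge0 (f : V -> R) K : (forall x y, `|f x| <= K /\ `|f x - f y| <= K * `|x - y|) -> 0 <= K.
Proof. by move=> /(_ 0 0)[/(le_trans (normr_ge0 _))]. Qed.

Lemma bounded_lipschitz_cst c : bounded_lipschitz (fun=> c).
Proof. by exists `|c| => x y; rewrite subrr normr0 mulr_ge0. Qed.

Lemma bounded_lipschitzD f g : bounded_lipschitz f -> bounded_lipschitz g -> bounded_lipschitz (fun x => f x + g x).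
Proof.
move=> [K1 H1] [K2 H2]; exists (K1 + K2) => x y.
have [a1 b1] := H1 x y; have [a2 b2] := H2 x y; split.
  by apply: le_trans (ler_normD _ _) _; exact: lerD.
have -> : f x + g x - (f y + g y) = (f x - f y) + (g x - g y) by ring.
by apply: le_trans (ler_normD _ _) _; rewrite mulrDl lerD.
Qed.

Lemma bounded_lipschitzM f g : bounded_lipschitz f -> bounded_lipschitz g -> bounded_lipschitz (fun x => f x * g x).
Proof.
move=> [K1 H1] [K2 H2]; have k1 := bounded_lipschitz_ge0 H1; have k2 := bounded_lipschitz_ge0 H2.
exists (2 * K1 * K2) => x y.
have [a1 b1] := H1 x y; have [a2 b2] := H2 x y; have [a3 _] := H2 y y; split.
  rewrite normrM; apply: le_trans (ler_pM _ _ a1 a2) _ => //.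
  by rewrite -mulrA mulr_natl mulr2n lerDl mulr_ge0.
have -> : f x * g x - f y * g y = f x * (g x - g y) + (f x - f y) * g y by ring.
apply: le_trans (ler_normD _ _) _; rewrite !normrM.
have -> : 2 * K1 * K2 * `|x - y| = K1 * (K2 * `|x - y|) + K1 * `|x - y| * K2 by ring.
by apply: lerD; apply: ler_pM.
Qed.

Lemma bounded_lipschitz_sum (I : Type) (s : seq I) (P : pred I) (f : I -> V -> R) :
  (forall i, bounded_lipschitz (f i)) -> bounded_lipschitz (fun x => \sum_(i <- s | P i) f i x).
Proof.
move=> H; elim: s => [|i s IH].
  by under eq_fun do rewrite big_nil; exact: bounded_lipschitz_cst.
under eq_fun do rewrite big_cons; case: (P i) => //; exact: bounded_lipschitzD.
Qed.

Lemma bounded_lipschitz_prod (I : Type) (s : seq I) (f : I -> V -> R) :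
  (forall i, bounded_lipschitz (f i)) -> bounded_lipschitz (fun x => \prod_(i <- s) f i x).
Proof.
move=> H; elim: s => [|i s IH].
  by under eq_fun do rewrite big_nil; exact: bounded_lipschitz_cst.
under eq_fun do rewrite big_cons; exact: bounded_lipschitzM.
Qed.

Lemma bounded_lipschitz_shift f (a : V) : bounded_lipschitz f -> bounded_lipschitz (fun x => f (x + a)).
Proof.
move=> [K H]; exists K => x y; have [h1 h2] := H (x + a) (y + a); split => //.
by move: h2; rewrite opprD addrACA subrr addr0.
Qed.

Lemma bounded_lipschitz_sin (i : 'I_d) (c : R) : 0 <= c <= 1 -> bounded_lipschitz (fun x => sin (x i 0 * c)).
Proof.
move=> /andP[c0 c1]; exists 1 => x y; split; first by rewrite ler_norml sin_geN1 sin_le1.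
rewrite mul1r; apply: le_trans (lipschitz_sin _ _) _.
rewrite -mulrBl normrM (ger0_norm c0) -[leRHS]mulr1 ler_pM//.
by have := coord_norm (x - y) i; rewrite !mxE.
Qed.

Lemma bounded_lipschitz_continuous f : bounded_lipschitz f -> continuous f.
Proof.
move=> [K H] x; have K0 := bounded_lipschitz_ge0 H; apply/(@cvgrPdist_le _ R^o _ (nbhs x)) => e e0.
near=> y; apply: le_trans (H x y).2 _.
apply: (@le_trans _ _ ((K + 1) * `|x - y|)); first by rewrite ler_wpM2r// lerDl.
rewrite -ler_pdivlMl ?ltr_wpDl// mulrC.
near: y; have /cvgr_dist_le := @cvg_id _ (nbhs x); apply.
by rewrite divr_gt0// ltr_wpDl.
Unshelve. all: by end_near. Qed.

End bounded_lipschitz.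

(** * The trigonometric polynomial G *)

Section trigG.
Context {R : realType} {d : nat}.
Local Notation V := 'cV[R]_d.
Variables (A : 'M[int]_d) (Q : 'M[R]_d).
Hypothesis hQ : elliptic_factor A Q.

Lemma Q2_sym i j : Q2 Q i j = Q2 Q j i.
Proof.
have [QT _ _] := hQ; have E : (Q2 Q)^T = Q2 Q by rewrite /Q2 trmx_mul QT.
by rewrite -{1}E mxE.
Qed.

Lemma sum_sym (f : 'I_d -> 'I_d -> R) : (forall i j, f i j = f j i) ->
  \sum_i \sum_j f i j = \sum_i f i i + 2 * (\sum_(i < d) \sum_(j < d | (i < j)%N) f i j).
Proof.
move=> fsym.
have E (i : 'I_d) : \sum_j f i j = f i i + (\sum_(j < d | (i < j)%N) f i j + \sum_(j < d | (j < i)%N) f i j).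
  rewrite (bigD1 i)//=; congr (_ + _).
  rewrite (bigID (fun j : 'I_d => (i < j)%N))/=; congr (_ + _); apply: eq_bigl => j.
    by case: ltngtP => // ij; rewrite ?andbT ?andbF// -val_eqE/= gtn_eqF.
  by rewrite -leqNgt -val_eqE/= ltn_neqAle.
under eq_bigr do rewrite E.
rewrite !big_split/= mulr_natl mulr2n; congr (_ + (_ + _)).
rewrite (exchange_big_dep xpredT)//=; apply: eq_bigr => i _; apply: eq_bigr => j _.
exact: fsym.
Qed.

Lemma formP_split (x : V) : formP Q x = \sum_(i < d) Q2 Q i i * x i 0 ^+ 2
  + 2 * (\sum_(i < d) \sum_(j < d | (i < j)%N) Q2 Q i j * (x i 0 * x j 0)).
Proof.
rewrite formP_sum sum_sym; last by move=> i j; rewrite Q2_sym (mulrC (x i 0)).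
by under eq_bigr do rewrite -expr2.
Qed.

(** With [s_i] and [c_i] the sine and cosine of [x_i / 2], one has [sin x_i = 2
    s_i c_i] and [s_i ^ 2 = s_i ^ 4 + s_i ^ 2 c_i ^ 2]; the mixed terms and the
    terms [s_i ^ 2 c_i ^ 2] make up the quadratic form at the vector of the
    [s_i c_i]. *)
Lemma trigG_sos (x : V) : trigG Q x =
  4 * (\sum_i Q2 Q i i * sin (x i 0 / 2) ^+ 4 +
       formP Q (\col_i (sin (x i 0 / 2) * cos (x i 0 / 2)))).
Proof.
have dbl (t : R) : sin t = 2 * (sin (t / 2) * cos (t / 2)).
  by rewrite [in LHS](splitr t) sinD; ring.
rewrite /trigG formP_split addrA -big_split/= mulrDr; congr (4 * _ + _).
  apply: eq_bigr => i _; rewrite mxE exprMn.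
  have -> : cos (x i 0 / 2) ^+ 2 = 1 - sin (x i 0 / 2) ^+ 2.
    by have := cos2Dsin2 (x i 0 / 2); lra.
  ring.
rewrite mulrA !mulr_sumr; apply: eq_bigr => i _; rewrite !mulr_sumr; apply: eq_bigr => j _.
by rewrite !mxE (dbl (x i 0)) (dbl (x j 0)); ring.
Qed.

Lemma Q2_diag_gt0 i : 0 < Q2 Q i i.
Proof.
have -> : Q2 Q i i = formP Q (evec i).
  rewrite formP_sum (bigD1 i)//= [X in _ + X]big1 ?addr0; last first.
    by move=> j ji; rewrite big1// => k _; rewrite [evec i j 0]mxE (negbTE ji) mul0r mulr0.
  rewrite (bigD1 i)//= big1 ?addr0; first by rewrite !mxE !eqxx !mulr1.
  by move=> k ki; rewrite [evec i k 0]mxE (negbTE ki) !mulr0.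
rewrite lt_def (formP_ge0 hQ) andbT; apply/negP => /eqP /(formP_eq0 hQ) e0.
by have := congr1 (fun v : V => v i 0) e0; rewrite !mxE !eqxx => /eqP; rewrite oner_eq0.
Qed.

(** The two terms of [trigG_sos] are nonnegative, and the first vanishes only
    if all [sin (x_i / 2)] do. *)
Lemma trigG_eq0 (x : V) : trigG Q x = 0 -> lattice2pi x.
Proof.
have s0 : 0 <= \sum_i Q2 Q i i * sin (x i 0 / 2) ^+ 4.
  by apply: sumr_ge0 => i _; rewrite mulr_ge0 ?(ltW (Q2_diag_gt0 i))// exprn_even_ge0.
move=> G0 i; have := trigG_sos x; rewrite G0.
have := formP_ge0 hQ (\col_i (sin (x i 0 / 2) * cos (x i 0 / 2))) => p0 E.
have : \sum_i Q2 Q i i * sin (x i 0 / 2) ^+ 4 = 0 by lra.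
move=> /eqP; rewrite psumr_eq0; last first.
  by move=> j _; rewrite mulr_ge0 ?(ltW (Q2_diag_gt0 j))// exprn_even_ge0.
move=> /allP/(_ i); rewrite mem_index_enum => /(_ isT) /=.
rewrite mulf_eq0 (gt_eqF (Q2_diag_gt0 i)) /= expf_eq0 /= => /eqP /sin0_int.
by rewrite invfM mulrA.
Qed.

Lemma trigG_periodic (x a : V) : lattice2pi a -> trigG Q (x + a) = trigG Q x.
Proof.
move=> la.
have p0 : pi != 0 :> R by rewrite gt_eqF ?pi_gt0.
have aE i : exists n : int, a i 0 = 2 * (n%:~R * pi).
  have aux (z p : R) : p != 0 -> z = 2 * (z / (2 * p) * p) by move=> ?; field.
  by have /intrP[n E] := la i; exists n; rewrite -E; exact: aux.
have s1 i : sin ((x + a) i 0) = sin (x i 0).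
  have [n E] := aE i; have [sn cn] := @sin_cos_int R n.
  have s2p : sin (2 * (n%:~R * pi)) = 0 :> R.
    by rewrite mulr_natl mulr2n sinD sn mulr0 mul0r addr0.
  have c2p : cos (2 * (n%:~R * pi)) = 1 :> R.
    by rewrite mulr_natl mulr2n cosD sn mulr0 subr0 -expr2.
  by rewrite mxE E sinD s2p c2p mulr1 mulr0 addr0.
have s2 i : sin ((x + a) i 0 / 2) ^+ 2 = sin (x i 0 / 2) ^+ 2.
  have [n E] := aE i; have [sn cn] := @sin_cos_int R n.
  rewrite mxE E mulrDl [2 * _]mulrC mulfK// sinD sn mulr0 addr0.
  by rewrite exprMn cn mulr1.
rewrite /trigG; congr (4 * _ + 2 * _); apply: eq_bigr => i _; first by rewrite s2.
by apply: eq_bigr => j _; rewrite !s1.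
Qed.

Lemma trigG0 : trigG Q 0 = 0.
Proof.
have z i : (0 : V) i 0 = 0 by rewrite mxE.
have E1 : \sum_(i < d) Q2 Q i i * sin ((0 : V) i 0 / 2) ^+ 2 = 0.
  by rewrite big1// => i _; rewrite z mul0r sin0 expr0n mulr0.
have E2 : \sum_(i < d) \sum_(j < d | (i < j)%N) Q2 Q i j * (sin ((0 : V) i 0) * sin ((0 : V) j 0)) = 0.
  by rewrite big1// => i _; rewrite big1// => j _; rewrite !z sin0 mul0r mulr0.
by rewrite /trigG E1 E2 !mulr0 addr0.
Qed.

Lemma trigG_lattice2pi (a : V) : lattice2pi a -> trigG Q a = 0.
Proof. by move=> la; rewrite -[a]add0r trigG_periodic// trigG0. Qed.

(** Each term of [trigG Q] agrees with the corresponding term of [formP Q] up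
    to third order, as [sin t - t = O(t ^ 2)]. *)
Lemma trigG_approx : exists2 c : R, 0 <= c &
  forall x : V, `|trigG Q x - formP Q x| <= c * `|x| ^+ 3.
Proof.
exists (\sum_i 2 * `|Q2 Q i i| + 2 * \sum_(i < d) \sum_(j < d | (i < j)%N) 2 * `|Q2 Q i j|).
  rewrite addr_ge0 ?mulr_ge0 ?sumr_ge0// => i _; rewrite ?mulr_ge0//.
  by rewrite sumr_ge0// => j _; rewrite mulr_ge0.
move=> x.
have sinle t : `|sin t| <= `|t| :> R by have := lipschitz_sin 0 t; rewrite sin0 !subr0.
have D1 i : `|4 * sin (x i 0 / 2) ^+ 2 - x i 0 ^+ 2| <= 2 * `|x| ^+ 3.
  set t := x i 0.
  have -> : 4 * sin (t / 2) ^+ 2 - t ^+ 2 =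
    2 * (sin (t / 2) - t / 2) * (2 * sin (t / 2) + t) by field.
  rewrite normrM normrM (ger0_norm (ler0n _ 2)).
  have h1 := sin_approx (t / 2).
  have h2 : `|2 * sin (t / 2) + t| <= 2 * `|t|.
    apply: le_trans (ler_normD _ _) _; rewrite normrM (ger0_norm (ler0n _ 2)).
    have := sinle (t / 2); rewrite normrM normfV (ger0_norm (ler0n _ 2)); lra.
  apply: (@le_trans _ _ (2 * (t / 2) ^+ 2 * (2 * `|t|))).
    by apply: ler_pM; rewrite ?mulr_ge0// ler_wpM2l.
  have -> : 2 * (t / 2) ^+ 2 * (2 * `|t|) = `|t| ^+ 3.
    rewrite [in RHS]exprS real_normK ?num_real//; by field.
  have := coord_norm x i; rewrite -/t => tx.
  apply: (@le_trans _ _ (`|x| ^+ 3)); first by rewrite lerXn2r ?nnegrE.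
  by rewrite mulr_natl mulr2n lerDl exprn_ge0.
have D2 i j : `|sin (x i 0) * sin (x j 0) - x i 0 * x j 0| <= 2 * `|x| ^+ 3.
  set s := x i 0; set t := x j 0.
  have -> : sin s * sin t - s * t = (sin s - s) * sin t + s * (sin t - t) by ring.
  apply: le_trans (ler_normD _ _) _; rewrite !normrM mulr_natl mulr2n.
  have sx : `|s| <= `|x| := coord_norm x i; have tx : `|t| <= `|x| := coord_norm x j.
  have sq (r : R) : `|r| <= `|x| -> r ^+ 2 <= `|x| ^+ 2.
    by move=> rx; rewrite -real_normK ?num_real// lerXn2r ?nnegrE.
  apply: lerD.
    rewrite exprSr; apply: ler_pM => //; last exact: le_trans (sinle t) tx.
    exact: le_trans (sin_approx s) (sq _ sx).
  by rewrite exprS; apply: ler_pM => //; exact: le_trans (sin_approx t) (sq _ tx).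
rewrite formP_split /trigG mulr_sumr.
have aux (a b c e : R) : a + 2 * b - (c + 2 * e) = (a - c) + 2 * (b - e) by ring.
rewrite aux.
apply: le_trans (ler_normD _ _) _; rewrite [leRHS]mulrDl; apply: lerD.
  rewrite -sumrB mulr_suml; apply: le_trans (ler_norm_sum _ _ _) _.
  apply: ler_sum => i _.
  have -> : 4 * (Q2 Q i i * sin (x i 0 / 2) ^+ 2) - Q2 Q i i * x i 0 ^+ 2 =
    Q2 Q i i * (4 * sin (x i 0 / 2) ^+ 2 - x i 0 ^+ 2) by ring.
  by rewrite normrM [2 * _]mulrC -mulrA ler_wpM2l.
rewrite normrM (ger0_norm (ler0n _ 2)) -mulrA ler_wpM2l// -sumrB mulr_suml.
apply: le_trans (ler_norm_sum _ _ _) _; apply: ler_sum => i _.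
rewrite -sumrB mulr_suml; apply: le_trans (ler_norm_sum _ _ _) _; apply: ler_sum => j _.
by rewrite -mulrBr normrM [2 * _]mulrC -mulrA ler_wpM2l.
Qed.

Lemma bounded_lipschitz_trigG : bounded_lipschitz (trigG Q).
Proof.
have h i : bounded_lipschitz (fun x : V => sin (x i 0 / 2)) by apply: bounded_lipschitz_sin; rewrite invr_ge0 invf_le1 ?ler0n ?ler1n.
have s i : bounded_lipschitz (fun x : V => sin (x i 0)).
  by have := @bounded_lipschitz_sin R d i 1; under eq_fun do rewrite mulr1; apply; rewrite ler01 lexx.
apply: bounded_lipschitzD; apply: bounded_lipschitzM; try exact: bounded_lipschitz_cst; apply: bounded_lipschitz_sum => i.
  by apply: bounded_lipschitzM; [exact: bounded_lipschitz_cst|under eq_fun do rewrite expr2; exact: bounded_lipschitzM].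
by apply: bounded_lipschitz_sum => j; apply: bounded_lipschitzM; [exact: bounded_lipschitz_cst|exact: bounded_lipschitzM].
Qed.

End trigG.

(** * The mask and its infinite product *)

Section mask.
Context {R : realType} {d : nat}.
Local Notation V := 'cV[R]_d.
Variables (A : 'M[int]_d) (Q : 'M[R]_d).
Hypothesis d_gt0 : (0 < d)%N.
Hypothesis hA : @isotropic_dilation R d A.
Hypothesis hQ : elliptic_factor A Q.
Local Notation B := (AmT A : 'M[R]_d).
Local Notation Bn n x := (iter n (mulmx B) x).
Local Notation rho := (@rho R d A).

(** A point [s] is determined by the integer vector [A^T s], whose entries are
    bounded because [s] lies in the unit cube. *)
Lemma SAT_finite : finite_set (SAT A : set V).
Proof.
have u := realAT_unit d_gt0 hA.
pose C : R := \sum_i \sum_j `|(realA A : 'M[R]_d)^T i j|.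
have [M HM] : exists M : nat, C < M%:R.
  by exists (Num.truncn C).+1; exact: truncnS_gt.
pose F (k : {ffun 'I_d -> 'I_(2 * M).+1}) : V :=
  invmx (realA A)^T *m \col_i ((k i : nat)%:R - M%:R).
apply: (@sub_finite_set _ _ (F @` setT)); last first.
  by apply: finite_image; exact: finite_finset.
move=> s [s01 sint].
have bd i : `|((realA A : 'M[R]_d)^T *m s) i 0| <= C.
  rewrite mxE; apply: le_trans (ler_norm_sum _ _ _) _.
  rewrite /C [leRHS](bigD1 i)//= ler_wpDr//.
    by apply: sumr_ge0 => k _; apply: sumr_ge0.
  apply: ler_sum => j _; rewrite normrM ler_piMr//.
  by have /andP[s0 s1] := s01 j; rewrite ger0_norm// ltW.
have kP i : exists k : 'I_(2 * M).+1, (k : nat)%:R - M%:R = ((realA A : 'M[R]_d)^T *m s) i 0.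
  have /intrP[z zE] := sint i.
  have zM : (`|z| < M%:Z)%R.
    by rewrite -(ltr_int R) intr_norm -zE (le_lt_trans (bd i)).
  have z0 : 0 <= z + M%:Z by lia.
  have lt : (absz (z + M%:Z)%R < (2 * M).+1)%N by lia.
  exists (Ordinal lt) => /=; rewrite zE.
  by rewrite pmulrn gez0_abs// intrD addrK.
have [k Hk] := choice kP.
exists [ffun i => k i] => //; rewrite /F.
have -> : \col_i (([ffun i => k i] i : nat)%:R - M%:R) = (realA A)^T *m s.
  by apply/colP => i; rewrite mxE ffunE Hk.
by rewrite mulmxA mulVmx// mul1mx.
Qed.

(** An explicit enumeration, which turns the product over a set in [m0] into an
    ordinary finite product. *)
Definition nonzero_SAT : seq V := finmap.enum_fset (fset_set (SAT A `\ 0)).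

Lemma mem_nonzero_SAT s : (s \in nonzero_SAT) <-> (SAT A s /\ s != 0).
Proof.
have fin : finite_set (SAT A `\ (0 : V)) by exact: finite_setD SAT_finite.
have -> : (s \in nonzero_SAT) = (s \in SAT A `\ 0) := in_fset_set fin s.
rewrite inE /=; split=> [[? /eqP ?]//|[? ?]]; split=> //; exact/eqP.
Qed.

Lemma m0E (x : V) : m0 A Q x = \prod_(s <- nonzero_SAT) (trigG Q (x + (2 * pi) *: s) / trigG Q ((2 * pi) *: s)).
Proof. by rewrite /m0 fsbig_finite//; exact: finite_setD SAT_finite. Qed.

Lemma lattice2piE (s : V) : lattice2pi ((2 * pi) *: s) <-> forall i, s i 0 \is a Num.int.
Proof.
have p0 : 2 * pi != 0 :> R by rewrite mulf_neq0 ?pnatr_eq0// gt_eqF ?pi_gt0.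
by split=> H i; have := H i; rewrite mxE mulrC mulKf.
Qed.

Lemma SAT_notin_lattice2pi (s : V) : SAT A s -> s != 0 -> ~ lattice2pi ((2 * pi) *: s).
Proof.
move=> [s01 _] /eqP s0 /lattice2piE H; apply: s0; apply/colP => i; rewrite mxE.
have /intrP[z zE] := H i; have := s01 i; rewrite zE ler0z ltrz1 => /andP[z0 z1].
by have -> : z = 0 by lia.
Qed.

Lemma m0_0 : m0 A Q 0 = 1.
Proof.
rewrite m0E big_seq big1// => s /mem_nonzero_SAT[sS s0].
rewrite add0r divff//; apply/eqP => /(trigG_eq0 hQ); exact: SAT_notin_lattice2pi.
Qed.

Lemma bounded_lipschitz_m0 : bounded_lipschitz (m0 A Q).
Proof.
have -> : m0 A Q = (fun x => \prod_(s <- nonzero_SAT) (trigG Q (x + (2 * pi) *: s) / trigG Q ((2 * pi) *: s))).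
  by apply/funext => x; exact: m0E.
apply: bounded_lipschitz_prod => s; apply: bounded_lipschitzM; last exact: bounded_lipschitz_cst.
by apply: bounded_lipschitz_shift; exact: bounded_lipschitz_trigG.
Qed.

(** If [x = 2 pi k], the fractional part [s] of [- B k] is a nonzero point of
    [SAT A], as [B k] is not integral; the factor of [m0 A Q (B x)] that
    belongs to [s] has as numerator the value of [trigG Q] at a lattice point.
    *)
Lemma m0_lattice2pi (x : V) : lattice2pi x -> ~ lattice2pi (B *m x) -> m0 A Q (B *m x) = 0.
Proof.
move=> lx nlx.
have p0 : 2 * pi != 0 :> R by rewrite mulf_neq0 ?pnatr_eq0// gt_eqF ?pi_gt0.
(* The vector [s'] is [B k], and [f] is the integral part of its opposite. *)
pose s' : V := (2 * pi)^-1 *: (B *m x).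
have s'E : B *m x = (2 * pi) *: s' by rewrite scalerA mulfV// scale1r.
pose f : V := \col_i (Num.floor (- s' i 0))%:~R.
pose s : V := - s' - f.
have sS : SAT A s.
  split=> i; first last.
  - rewrite mulmxBr mulmxN -scalemxAr (mul_realAT_AmT d_gt0 hA) mxE rpredD//.
      by rewrite !mxE rpredN; have := lx i; rewrite mulrC.
    rewrite mxE rpredN mxE; apply: rpred_sum => j _; rewrite !mxE.
    by rewrite rpredM// intr_int.
  - rewrite [s i 0]mxE [(- s') i 0]mxE [(- f) i 0]mxE [f i 0]mxE.
    have := floor_itv (- s' i 0); rewrite intrD; lra.
have sf : s' + s = - f by rewrite /s addrA subrr add0r.
have sN0 : s != 0.
  apply/eqP => s0; apply: nlx; rewrite s'E; apply/lattice2piE => i.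
  move: sf; rewrite s0 addr0 => ->; by rewrite !mxE rpredN intr_int.
rewrite m0E (bigD1_seq s) /=; [|by apply/mem_nonzero_SAT|exact: finmap.fset_uniq].
rewrite s'E -scalerDr sf (trigG_lattice2pi Q) ?mul0r//.
by apply/lattice2piE => i; rewrite !mxE rpredN intr_int.
Qed.

(** The partial products of [phihat], indexed from 0. *)
Definition phihat_partial (x : V) n := \prod_(0 <= j < n) m0 A Q (Bn j.+1 x).

Lemma phihatE (x : V) : phihat A Q x = limn (phihat_partial x).
Proof.
rewrite /phihat.
have -> // : (fun n => \prod_(1 <= j < n.+1) m0 A Q (Bn j x)) = phihat_partial x.
by apply/funext => n; rewrite big_add1.
Qed.

Lemma m0_iter_sub1 : exists2 K : R, 0 <= K &
  forall j (x : V), `|m0 A Q (Bn j.+1 x) - 1| <= K * `|x| * rho ^+ j.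
Proof.
have [L HL] := bounded_lipschitz_m0; have L0 := bounded_lipschitz_ge0 HL.
have [K K1 HK] := iter_AmT_norm d_gt0 hA hQ.
have r0 := rho_gt0 d_gt0 hA; have r1 := rho_lt1 d_gt0 hA.
exists (L * K) => [|j x]; first by rewrite mulr_ge0// (le_trans ler01).
have := (HL (Bn j.+1 x) 0).2; rewrite m0_0 subr0 => /le_trans; apply.
rewrite -!mulrA ler_wpM2l//; apply: le_trans (HK _ _) _.
rewrite -mulrA ler_wpM2l// ?(le_trans ler01)// mulrC ler_wpM2l// exprS.
by rewrite ler_piMl ?exprn_ge0 ?ltW.
Qed.

Lemma rho01 : 0 <= rho < 1.
Proof. by rewrite ltW ?rho_gt0 ?rho_lt1. Qed.

Lemma cvg_phihat_partial (x : V) : phihat_partial x @ \oo --> phihat A Q x.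
Proof.
have [K K0 HK] := m0_iter_sub1.
rewrite phihatE.
suff : cvgn (phihat_partial x) by [].
apply: (@is_cvg_infinite_prod _ (fun j => m0 A Q (Bn j.+1 x)) (K * `|x|) rho) => [||j].
- by rewrite mulr_ge0.
- exact: rho01.
- exact: HK.
Qed.

Lemma phihat_rec (x : V) : phihat A Q x = m0 A Q (B *m x) * phihat A Q (B *m x).
Proof.
have : (fun n => phihat_partial x n.+1) @ \oo --> m0 A Q (B *m x) * phihat A Q (B *m x).
  have -> : (fun n => phihat_partial x n.+1) = (fun n => m0 A Q (B *m x) * phihat_partial (B *m x) n).
    apply/funext => n; rewrite /phihat_partial big_nat_recl//=; congr (_ * _).
    by apply: eq_bigr => j _; rewrite -iterSr.
  by apply: cvgMr; exact: cvg_phihat_partial.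
have : (fun n => phihat_partial x n.+1) @ \oo --> phihat A Q x.
  by have := @cvg_phihat_partial x; rewrite -(cvg_shiftS (phihat_partial x)).
move=> h1 h2; exact: (cvg_unique _ h1 h2).
Qed.

(** The iterates of [x] under [B] tend to 0 without reaching it, so some
    iterate is the last one in the lattice, and the next factor of the product
    vanishes by [m0_lattice2pi]. *)
Lemma phihat_lattice2pi (x : V) : lattice2pi x -> x != 0 -> phihat A Q x = 0.
Proof.
move=> lx x0.
have [j Hj] : exists j, ~ lattice2pi (Bn j x).
  have [K K1 HK] := iter_AmT_norm d_gt0 hA hQ.
  have r0 := rho_gt0 d_gt0 hA.
  have : K * `|x| * rho ^+ n @[n --> \oo] --> K * `|x| * 0.
    by apply: cvgMr; apply: cvg_expr; rewrite ger0_norm ?rho_lt1// ltW.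
  rewrite mulr0 => /cvgr0_norm_lt/(_ _ (@ltr01 R))[n _ Hn].
  exists n => ln.
  have small : `|Bn n x| < 1.
    apply: le_lt_trans (HK n x) _; rewrite mulrAC.
    by apply: le_lt_trans (Hn n (leqnn n)); rewrite ler_norm.
  have Bn0 : Bn n x = 0.
    apply/colP => i; rewrite [RHS]mxE; have /intrP[z zE] := ln i.
    have p0 : 2 * pi != 0 :> R by rewrite mulf_neq0 ?pnatr_eq0// gt_eqF ?pi_gt0.
    have E : Bn n x i 0 = z%:~R * (2 * pi) by rewrite -zE divfK.
    have := le_lt_trans (coord_norm _ i) small; rewrite E normrM.
    have p1 : 1 <= `|2 * pi| :> R by rewrite ger0_norm ?mulr_ge0 ?pi_ge0//; have := pi_ge2 R; lra.
    have [->|z0] := eqVneq z 0; first by rewrite mul0r.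
    have z1 : 1 <= `|z%:~R| :> R.
      by rewrite -intr_norm -[1 in X in X <= _]/(1%:~R) ler_int; lia.
    by move=> H; have := le_lt_trans (ler_pM ler01 ler01 z1 p1) H; rewrite mulr1 ltxx.
  move: x0; apply/negP; rewrite negbK; apply/eqP.
  suff H (k : nat) (y : V) : Bn k y = 0 -> y = 0 by exact: H Bn0.
  elim: k y => [y E|k IH y /= E]; first exact: E.
  apply: IH.
  by rewrite -(mul_realAT_AmT d_gt0 hA (Bn k y)) E mulmx0.
elim: j x lx {x0} Hj => [x lx /(_ lx)//|j IH x lx]; rewrite iterSr => Hj.
rewrite phihat_rec; have [lB|nlB] := pselect (lattice2pi (B *m x)).
  by rewrite IH// mulr0.
by rewrite m0_lattice2pi// mul0r.
Qed.

Lemma lattice2pi_iter n (x : V) : lattice2pi (Bn n x) -> lattice2pi x.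
Proof. by elim: n => //= n IH /(lattice2pi_AmT d_gt0 hA). Qed.

(** The partial products of [prodM] telescope, because each factor of [mu]
    contains the quotient of two consecutive values of [trigG Q]; none of these
    is zero, since [x] would be in the lattice if some [B ^ n x] were. *)
Lemma prodM_phihat (x : V) : ~ lattice2pi x ->
  prodM A Q x = formP Q x / trigG Q x * phihat A Q x.
Proof.
move=> nlx.
have nlB n : ~ lattice2pi (Bn n x) by move=> /lattice2pi_iter.
have G0 n : trigG Q (Bn n x) != 0 by apply/eqP => /(trigG_eq0 hQ)/nlB.
have r0 := rho_gt0 d_gt0 hA.
pose q2 : R := powR (qdet A) (2 / d%:R).
have q2E n : q2 ^+ n = (rho ^+ n) ^- 2.
  apply: (@mulIf _ ((rho ^+ n) ^+ 2)); first by rewrite !expf_neq0// gt_eqF.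
  rewrite mulVf; last by rewrite !expf_neq0// gt_eqF.
  by rewrite exprAC -exprMn (rho_sqr d_gt0 hA) expr1n.
have E n : \prod_(0 <= j < n) mu A Q (Bn j x) =
    q2 ^+ n * trigG Q (Bn n x) / trigG Q x * phihat_partial x n.
  elim: n => [|n IH]; first by rewrite /phihat_partial !big_geq// expr0 mul1r mulr1 divff// (G0 0%N).
  rewrite big_nat_recr//= IH /phihat_partial big_nat_recr//= /mu.
  case: asboolP => [/nlB//|_]; rewrite /mu_quot -/q2 exprS; field.
  by rewrite (G0 n) (G0 0%N).
rewrite /prodM; under eq_fun do rewrite E.
apply: cvg_lim => //; apply: cvgM; last exact: cvg_phihat_partial.
apply: cvgMl.
have [c c0 Hc] := @trigG_approx R d A Q hQ.
have [K K1 HK] := iter_AmT_norm d_gt0 hA hQ.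
have bnd n : `|q2 ^+ n * trigG Q (Bn n x) - formP Q x| <= c * (K * `|x|) ^+ 3 * rho ^+ n.
  have rn0 : 0 < rho ^+ n by rewrite exprn_gt0.
  have -> : formP Q x = q2 ^+ n * formP Q (Bn n x).
    by rewrite (formP_iter hQ) q2E mulrA mulVf ?mul1r// expf_neq0// gt_eqF.
  rewrite -mulrBr normrM q2E (ger0_norm (ltW _)); last by rewrite invr_gt0 exprn_gt0.
  rewrite mulrC ler_pdivrMr ?exprn_gt0//.
  have -> : c * (K * `|x|) ^+ 3 * rho ^+ n * (rho ^+ n) ^+ 2 = c * (K * rho ^+ n * `|x|) ^+ 3.
    by ring.
  apply: le_trans (Hc _) _; rewrite ler_wpM2l// lerXn2r ?nnegrE//.
  by rewrite !mulr_ge0 ?(ltW rn0) ?(le_trans ler01 K1).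
apply/cvgrPdist_le => e e0.
have : c * (K * `|x|) ^+ 3 * rho ^+ n @[n --> \oo] --> c * (K * `|x|) ^+ 3 * 0.
  by apply: cvgMr; apply: cvg_expr; rewrite ger0_norm ?rho_lt1// ltW.
rewrite mulr0 => /cvgr0_norm_le/(_ _ e0); apply: filterS => n Hn.
rewrite distrC; apply: le_trans (bnd n) _; exact: le_trans (ler_norm _) Hn.
Qed.

(** On the lattice, and where [phihat] vanishes, both sides are 0, because the
    exponents on the right are positive; elsewhere [prodM_phihat] gives the
    value of [prodM], which is then nonzero. *)
Lemma Delta_symbol_phihat (x : V) j m :
  formP Q x / prodM A Q x * (trigG Q x ^+ j * phihat A Q x ^+ m.+2) =
  trigG Q x ^+ j.+1 * phihat A Q x ^+ m.+1.
Proof.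
have [lx|nlx] := pselect (lattice2pi x).
  rewrite (trigG_lattice2pi Q lx) [in RHS]exprS !mul0r.
  have [->|x0] := eqVneq x 0; first by rewrite (formP0 hQ) !mul0r.
  by rewrite (phihat_lattice2pi lx x0) [0 ^+ m.+2]exprS mul0r !mulr0.
have G0 : trigG Q x != 0 by apply/eqP => /(trigG_eq0 hQ).
have [p0|p0] := eqVneq (phihat A Q x) 0; first by rewrite p0 [0 ^+ m.+2]exprS [0 ^+ m.+1]exprS !mul0r !mulr0.
have P0 : formP Q x != 0.
  apply/eqP => /(formP_eq0 hQ) x0; apply: nlx; rewrite x0 => i.
  by rewrite mxE mul0r rpred0.
rewrite (prodM_phihat nlx) !exprS; field.
by rewrite P0 p0 G0.
Qed.

End mask.

(** * Functions of polynomial growth *)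

Section tempered_functions.
Context {R : realType} {d : nat}.
Local Notation V := 'cV[R]_d.
Local Notation T := (d.-tuple (measurableTypeR R)).

Lemma growsM (f g : V -> R) : grows f -> grows g -> grows (fun x => f x * g x).
Proof.
move=> [M [K1 H1]] [N [K2 H2]]; exists (M + N)%N, (K1 * K2) => x.
rewrite normrM exprD mulrACA; exact: ler_pM.
Qed.

Lemma growsX (f : V -> R) n : grows f -> grows (fun x => f x ^+ n).
Proof.
move=> fg; elim: n => [|n IH].
  by exists 0%N, 1 => x; rewrite !expr0 normr1 mulr1.
by under eq_fun do rewrite exprS; exact: growsM.
Qed.

(** If the growth exponent is [M], division by [(1 + |x|) ^ (M + 2 d)] gives an
    integrable function. *)
Lemma tempered_fun_grows (g : V -> R) :
  measurable_fun setT (g \o col_of_tuple : T -> R) -> grows g ->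
  tempered_fun (fun x => real_complex R (g x)).
Proof.
move=> mg [M [K H]]; split.
- exact: mg.
- exact: measurable_cst.
- exists (M + 2 * d)%N.
  pose f (x : V) := `|g x| / (1 + `|x|) ^+ (M + 2 * d).
  have cR (r : R) : cmod (real_complex R r) = `|r|.
    by rewrite cmodE /= expr0n addr0 sqrtr_sqr.
  have -> : (fun t : T => (cmod (real_complex R (g (col_of_tuple t))) /
      (1 + `|col_of_tuple t|) ^+ (M + 2 * d))%:E) = EFin \o (f \o col_of_tuple).
    by apply/funext => t; rewrite cR.
  apply: (@integrableV_dominated _ _ f K).
    apply: measurable_funM; first exact: measurableT_comp.
    apply: (@measurable_continuous_col R d (fun x => ((1 + `|x|) ^+ (M + 2 * d))^-1)) => x.
    apply: (@cvgV R V (nbhs x)); first by rewrite expf_neq0// gt_eqF// ltr_pwDl.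
    elim: (M + 2 * d)%N => [|n IH].
      by under eq_fun do rewrite expr0; exact: cvg_cst.
    under eq_fun do rewrite exprS; rewrite exprS.
    apply: cvgM => //; apply: cvgD; [exact: cvg_cst|exact: norm_continuous].
  move=> x; rewrite /f normrM normr_id normfV (ger0_norm (exprn_ge0 _ _)) ?addr_ge0//.
  have w0 : 0 < 1 + `|x| by rewrite ltr_pwDl.
  have aux (a b z : R) : a != 0 -> b != 0 -> a * (z / (b * a)) = z / b.
    by move=> a0 b0; field; rewrite a0 b0.
  by rewrite exprD aux ?expf_neq0 ?(gt_eqF w0)// ler_pdivrMr ?exprn_gt0.
Qed.

End tempered_functions.

(** * Elliptic scaling functions *)

Section scaling_function.
Context {R : realType} {d : nat}.
Local Notation V := 'cV[R]_d.
Local Notation T := (d.-tuple (measurableTypeR R)).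
Variables (A : 'M[int]_d) (Q : 'M[R]_d).
Hypothesis d_gt0 : (0 < d)%N.
Hypothesis hA : @isotropic_dilation R d A.
Hypothesis hQ : elliptic_factor A Q.
Local Notation B := (AmT A : 'M[R]_d).
Local Notation Bn n x := (iter n (mulmx B) x).
Local Notation rho := (@rho R d A).

Lemma bounded_lipschitz_m0_iter n : bounded_lipschitz (fun x => m0 A Q (Bn n x)).
Proof.
have [L HL] := bounded_lipschitz_m0 Q d_gt0 hA; have L0 := bounded_lipschitz_ge0 HL.
have [K K1 HK] := iter_AmT_norm d_gt0 hA hQ.
have K0 : 0 <= K := le_trans ler01 K1.
exists (L * K) => x y; have [h1 h2] := HL (Bn n x) (Bn n y); split.
  by apply: le_trans h1 _; rewrite ler_peMr.
apply: le_trans h2 _; rewrite iter_AmTB -mulrA ler_wpM2l//; apply: le_trans (HK _ _) _.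
rewrite ler_wpM2r// ler_piMr// exprn_ile1 ?(ltW (rho_gt0 d_gt0 hA)) ?(ltW (rho_lt1 d_gt0 hA))//.
Qed.

Lemma measurable_phihat : measurable_fun setT (phihat A Q \o col_of_tuple : T -> R).
Proof.
apply: (@measurable_fun_cvg _ _ _ _ (fun n (t : T) => phihat_partial A Q (col_of_tuple t) n)) => [n|t _].
  apply: measurable_prod => j _.
  apply: (@measurable_continuous_col R d (fun x => m0 A Q (Bn j.+1 x))).
  by apply: bounded_lipschitz_continuous; exact: bounded_lipschitz_m0_iter.
exact: (@cvg_phihat_partial R d A Q d_gt0 hA hQ).
Qed.

(** The factors approach 1 geometrically, with a constant proportional to
    [|x|]; so the product is bounded on balls. *)
Lemma phihat_local : exists2 K : R, 0 <= K & forall x : V, `|phihat A Q x| <= expR (K * `|x|).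
Proof.
have [K K0 HK] := m0_iter_sub1 d_gt0 hA hQ.
have r1 : 0 < 1 - rho by rewrite subr_gt0 rho_lt1.
exists (K / (1 - rho)) => [|x]; first by rewrite divr_ge0 // ltW.
have h : `|phihat_partial A Q x n| @[n --> \oo] --> `|phihat A Q x|.
  by apply: cvg_norm; exact: (@cvg_phihat_partial R d A Q d_gt0 hA hQ x).
have h2 n : `|phihat_partial A Q x n| <= expR (K * `|x| / (1 - rho)).
  apply: infinite_prod_bound; first by rewrite mulr_ge0.
    exact: rho01.
  by move=> j; exact: HK.
rewrite mulrAC -(cvg_lim _ h)//; apply: limr_le; first by apply/cvg_ex; exists `|phihat A Q x|.
by apply: nearW.
Qed.

(** Take [k] minimal with [rho ^ k * (1 + |x|) <= 1].  Then [B ^ k x] lies in a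
    fixed ball, where [phihat] is bounded, and the first [k] factors contribute
    at most [M ^ k], where [M] bounds [m0]; this is at most a power of [1 +
    |x|], because [k] is logarithmic in [1 + |x|]. *)
Lemma grows_phihat : grows (phihat A Q).
Proof.
have [L HL] := bounded_lipschitz_m0 Q d_gt0 hA; have L0 := bounded_lipschitz_ge0 HL.
have [K1 K11 HK1] := iter_AmT_norm d_gt0 hA hQ.
have [K K0 HK] := phihat_local.
have r0 := rho_gt0 d_gt0 hA; have r1 := rho_lt1 d_gt0 hA.
pose M := L + 1; have M1 : 1 <= M by rewrite lerDr.
have rcvg : rho ^+ n @[n --> \oo] --> (0 : R) by apply: cvg_expr; rewrite ger0_norm// ltW.
have small (c : R) : 0 < c -> exists n, rho ^+ n * c <= 1.
  move=> c0; have ci : 0 < c^-1 by rewrite invr_gt0.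
  have /cvgr0_norm_le/(_ _ ci)[n _ Hn] := rcvg; exists n.
  rewrite -ler_pdivlMr// div1r; apply: le_trans (Hn n (leqnn n)); exact: ler_norm.
(* The exponent of growth: [M <= rho ^ (- N)]. *)
have [N HN] := small M (lt_le_trans ltr01 M1).
have iterM k x : `|phihat A Q x| <= M ^+ k * `|phihat A Q (Bn k x)|.
  elim: k x => [|k IH] x; first by rewrite expr0 mul1r.
  rewrite iterSr phihat_rec// normrM exprS -mulrA; apply: ler_pM => //.
  by apply: le_trans (HL (B *m x) 0).1 _; rewrite lerDl.
exists N, (expR (K * K1) * rho^-1 ^+ N) => x.
have w0 : 1 <= 1 + `|x| by rewrite lerDl.
have ex : exists k, rho ^+ k * (1 + `|x|) <= 1 by apply: small; rewrite (lt_le_trans ltr01).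
case: (ex_minnP ex) => k Hk kmin.
have Bk : `|Bn k x| <= K1.
  apply: le_trans (HK1 _ _) _; rewrite -mulrA ler_piMr ?(le_trans ler01 K11)//.
  by apply: le_trans Hk; rewrite ler_wpM2l ?exprn_ge0 ?(ltW r0)// lerDr.
have Mk : M ^+ k <= (rho^-1 * (1 + `|x|)) ^+ N.
  case: k Hk kmin Bk => [|k] Hk kmin _.
    by rewrite expr0 exprn_ege1// mulr_ege1// invf_ge1// ltW.
  have H1 : 1 <= rho ^+ k * (1 + `|x|).
    by rewrite leNgt; apply/negP => /ltW/kmin; rewrite ltnn.
  (* By minimality of [k], a factor that is at least 1 is available to absorb the powers of [rho]. *)
  apply: (@le_trans _ _ ((rho ^+ N * M) ^+ k.+1 * (rho^-1 * (1 + `|x|)) ^+ N)); last first.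
    rewrite ler_piMl ?exprn_ge0 ?mulr_ge0 ?invr_ge0 ?addr_ge0 ?(ltW r0)//.
    by rewrite exprn_ile1 ?mulr_ge0 ?exprn_ge0 ?(ltW r0) ?(le_trans ler01 M1).
  have -> : (rho ^+ N * M) ^+ k.+1 * (rho^-1 * (1 + `|x|)) ^+ N =
      M ^+ k.+1 * (rho ^+ k * (1 + `|x|)) ^+ N.
    rewrite exprMn -exprM mulnC exprM -mulrA mulrCA -exprMn; congr (_ * _ ^+ _).
    by rewrite mulrA exprSr mulfK// gt_eqF.
  by rewrite ler_peMr ?exprn_ge0 ?(le_trans ler01 M1)// exprn_ege1.
apply: le_trans (iterM k x) _.
rewrite -mulrA -exprMn mulrC; apply: ler_pM => //; first by rewrite exprn_ge0 ?(le_trans ler01 M1).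
by apply: le_trans (HK _) _; rewrite ler_expR ler_wpM2l.
Qed.

Variable phi : nat -> @dist R d.
Hypothesis hphi : forall m : nat, (0 < m)%N -> elliptic_scaling A Q m (phi m).

(** The Fourier transform of the [j]th image under [calG Q] of the scaling
    function of order [m]. *)
Definition symbol_fun j m (x : V) : R := trigG Q x ^+ j * phihat A Q x ^+ m.

Lemma tempered_symbol_fun j m : tempered_fun (fun x => real_complex R (symbol_fun j m x)).
Proof.
apply: tempered_fun_grows.
  apply: measurable_funM.
    apply: measurable_funX; apply: measurable_continuous_col.
    by apply: bounded_lipschitz_continuous; exact: bounded_lipschitz_trigG.
  by apply: measurable_funX; exact: measurable_phihat.
apply: growsM; apply: growsX; last exact: grows_phihat.
have [K HK] := @bounded_lipschitz_trigG R d Q.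
by exists 0%N, K => x; rewrite expr0 mulr1; exact: (HK x x).1.
Qed.

(** The symbol rule for [calG Q] moves a factor [trigG Q] onto the test
    function, and from there into the function that represents the Fourier
    transform. *)
Lemma iter_calG_fourier j m : (0 < m)%N ->
  tempered (iter j (calG Q) (phi m)) /\
  dist_eq (dist_fourier (iter j (calG Q) (phi m)))
    (regular (fun x => real_complex R (symbol_fun j m x))).
Proof.
move=> m0; elim: j => [|j [IH1 IH2]].
  have [pt pE] := hphi m0; split => //.
  have -> // : (fun x => real_complex R (symbol_fun 0 m x)) =
    (fun x => real_complex R (phihat A Q x ^+ m)).
  by apply/funext => x; rewrite /symbol_fun expr0 mul1r.
have [GS GH] := has_symbol_calG Q; have [ct cE] := GH _ IH1; split => // psi psiS.
rewrite /= /dist_fourier cE//.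
rewrite -[LHS]/(dist_fourier (iter j (calG Q) (phi m)) (fun x => G_symbol Q x * psi x)).
rewrite IH2; last exact: GS.
rewrite /regular; congr cintegral; apply/funext => x.
rewrite mulrA; congr (_ * _); rewrite /G_symbol -rmorphM; congr (real_complex R _).
by rewrite /symbol_fun exprS; ring.
Qed.

Lemma symbol_op_Delta j m : symbol_op (Delta_symbol A Q)
  (iter j (calG Q) (phi m.+2)) (iter j.+1 (calG Q) (phi m.+1)).
Proof.
have [t1 E1] := iter_calG_fourier j (ltn0Sn m.+1).
have [t2 E2] := iter_calG_fourier j.+1 (ltn0Sn m).
have E : (fun x => real_complex R (symbol_fun j.+1 m.+1 x)) =
    (fun x => Delta_symbol A Q x * real_complex R (symbol_fun j m.+2 x)).
  apply/funext => x; rewrite /Delta_symbol -rmorphM /symbol_fun.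
  by rewrite (Delta_symbol_phihat d_gt0 hA hQ).
split => //; apply: (dist_prod_regular (h := fun x => real_complex R (symbol_fun j m.+2 x))) => //.
- exact: tempered_symbol_fun.
- by rewrite -E; exact: tempered_symbol_fun.
- by rewrite -E.
Qed.

(** Each application of the operator with symbol [P / M] lowers the order of
    the scaling function by one and contributes one more [calG Q]; the images
    under [calG Q] are carried along by [j]. *)
Lemma op_iter_Delta k j m : (k < m)%N ->
  op_iter (symbol_op (Delta_symbol A Q)) k
    (iter j (calG Q) (phi m)) (iter (k + j) (calG Q) (phi (m - k)%N)).
Proof.
elim: k j m => [|k IH] j m km; first by rewrite subn0.
case: m km => [|[|m]]// km.
exists (iter j.+1 (calG Q) (phi m.+1)); first exact: symbol_op_Delta.
by rewrite addSnnS subSS; exact: IH.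
Qed.

End scaling_function.

Theorem theorem4p2 (R : realType) (d : nat) (d_gt0 : (0 < d)%N)
    (A : 'M[int]_d) (Q : 'M[R]_d)
    (hA : @isotropic_dilation R d A) (hQ : elliptic_factor A Q)
    (phi : nat -> @dist R d)
    (hphi : forall m : nat, (0 < m)%N -> elliptic_scaling A Q m (phi m)) :
  (forall k m : nat, (0 < k)%N -> (k < m)%N ->
     op_iter (symbol_op (Delta_symbol A Q)) k (phi m)
       (iter k (calG Q) (phi (m - k)%N)))
  /\ (forall u : @dist R d, tempered u ->
        symbol_op (G_symbol Q) u (calG Q u)).
Proof.
split=> [k m _ km|u]; last exact: symbol_op_calG.
by have := op_iter_Delta d_gt0 hA hQ hphi 0 km; rewrite addn0.
Qed.
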